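(* Let $G$ be a connected graph with distance matrix $D(G)$ whose second largest eigenvalue satisfies $\lambda_{2}(D(G))\leq\frac{17-\sqrt{329}}{2}\approx-0.5692$. Then $G$ is determined by its $D$-spectrum: every connected graph $H$ whose distance matrix $D(H)$ has the same spectrum (eigenvalues with multiplicities) as $D(G)$ is isomorphic to $G$.
   Context: All graphs are simple, undirected and connected. The distance matrix $D(G)=(d_{ij})$ of a connected graph $G$ on vertices $v_1,\dots,v_n$ has $d_{ij}$ equal to the distance between $v_i$ and $v_j$. Its eigenvalues are ordered $\lambda_{1}(D(G))\geq\lambda_{2}(D(G))\geq\cdots\geq\lambda_{n}(D(G))$ (the $D$-spectrum). *)

(* Defs.v *)
From mathcomp Require Import all_boot all_order all_algebra.
Set Implicit Arguments. Unset Strict Implicit. Unset Printing Implicit Defensive.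
Import Order.TTheory GRing.Theory Num.Theory.
Local Open Scope ring_scope.

Definition simple_graph (n : nat) (e : rel 'I_n) : Prop :=
  symmetric e /\ irreflexive e.

Definition connected_graph (n : nat) (e : rel 'I_n) : Prop :=
  forall i j : 'I_n, connect e i j.

Definition ball (n : nat) (e : rel 'I_n) (k : nat) (i : 'I_n) : {set 'I_n} :=
  iter k (fun A => A :|: [set y | [exists x in A, e x y]]) [set i].

(* Graph distance: least k with j in ball e k i (in a connected graph on n
   vertices, distances are < n, so the search over 0..n-1 is exhaustive). *)
Definition gdist (n : nat) (e : rel 'I_n) (i j : 'I_n) : nat :=
  find (fun k => j \in ball e k i) (iota 0 n).

Definition distmx (R : nzRingType) (n : nat) (e : rel 'I_n) : 'M[R]_n :=
  \matrix_(i, j) (gdist e i j)%:R.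

Definition is_Dspectrum (R : rcfType) (n : nat) (e : rel 'I_n) (s : seq R) : Prop :=
  sorted (fun x y => y <= x) s /\
  char_poly (distmx R e) = \prod_(x <- s) ('X - x%:P).

Definition graph_iso (n m : nat) (e : rel 'I_n) (f : rel 'I_m) : Prop :=
  exists g : 'I_n -> 'I_m, bijective g /\ forall i j, f (g i) (g j) = e i j.

(* Main.v *)
Require Import Defs.
From Stdlib Require Import ZArith.
From mathcomp Require Import all_boot all_order all_algebra.
From mathcomp Require Import fingroup perm complex spectral sesquilinear.
From mathcomp Require Import ssrZ zify ring lra.
Set Implicit Arguments. Unset Strict Implicit. Unset Printing Implicit Defensive.
Import Order.TTheory GRing.Theory Num.Theory.

(** By interlacing, every isometric subset of a graph with
    lambda_2 <= (17 - sqrt 329) / 2 has lambda_2 below the same bound. This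
    forbids C4, the diamond, C5 and P5, and it forbids all but four ways of
    placing a fifth vertex at distances 1, 2 or 3 from an isometric P4.
    If the diameter is at most 2, the graph therefore has a universal vertex whose
    removal leaves a disjoint union of cliques (a windmill); otherwise it is a
    clique with at least two pendant vertices, attached to distinct clique vertices.

    For a windmill with cliques of sizes a_1, ..., a_r and N = n - 1, put
    W(y) = prod_i y^(a_i - 1) (y + a_i). The determinant of the rank-two
    perturbation y + diag(J_(a_i)) - V S V^T gives
    char_poly(y - 1) = (y - 1) W - (2 y - 1) (N W - y W'), and W, hence the multiset
    of the a_i, is recovered from the right-hand side.
    For a clique with t pendant vertices the sum of the squared distances is
    n^2 - n + 6 n t + 2 t^2 - 14 t, which determines t.
    Finally a windmill has at most two eigenvalues above -1, while a clique with two
    pendant vertices contains the bull, which has three, or is P4, whose sum of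
    squared distances is too large. *)

(** * Graph distance *)

Lemma ballP n (e : rel 'I_n) k i j :
  reflect (exists p, [/\ path e i p, last i p = j & size p <= k])
          (j \in ball e k i).
Proof.
elim: k j => [|k IHk] j.
  rewrite inE; apply: (iffP eqP) => [->|[p [_ <-]]]; first by exists [::].
  by rewrite leqn0 size_eq0 => /eqP->.
rewrite [ball _ _ _]/= -/(ball e k i) !inE.
apply: (iffP orP) => [[/IHk[p [ep lp sp]]|/existsP[x /andP[/IHk[p [ep lp sp]] exj]]]|].
- by exists p; split=> //; apply: leqW.
- by exists (rcons p j); rewrite rcons_path last_rcons size_rcons lp ep exj.
case=> p [+ <- {j}]; case/lastP: p => [|p j]; first by left; apply/IHk; exists [::].
rewrite rcons_path last_rcons size_rcons => /andP[ep exj] sp; right.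
by apply/existsP; exists (last i p); rewrite exj andbT; apply/IHk; exists p.
Qed.

Section Distance.
Variables (n : nat) (e : rel 'I_n).
Hypotheses (simple_e : simple_graph e) (connected_e : connected_graph e).
Local Notation d := (gdist e).

Lemma gdist_path i j : exists p, [/\ path e i p, last i p = j & size p = d i j].
Proof.
have [p0 ep0 lp0] := connectP (connected_e i j).
case/shortenP: ep0 lp0 => q eq uq _ lq.
(* A duplicate-free path has fewer than [n] edges, so the search over [iota 0 n] succeeds. *)
have sq : size q < n.
  by have := max_card (mem (i :: q)); rewrite card_ord (card_uniqP uq).
have hasd : has (fun k => j \in ball e k i) (iota 0 n).
  apply/hasP; exists (size q); first by rewrite mem_iota.
  by apply/ballP; exists q.
have := nth_find 0 hasd; rewrite -/(d i j).
have dn : d i j < n by rewrite -[n in X in _ < X](size_iota 0) -has_find.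
rewrite nth_iota // add0n => /ballP[p [ep lp sp]]; exists p; split=> //.
apply/eqP; rewrite eqn_leq sp leqNgt; apply/negP => lt_pd.
have := before_find 0 lt_pd.
rewrite nth_iota ?(leq_trans lt_pd) ?(ltnW dn) // add0n.
by move/negP; apply; apply/ballP; exists p.
Qed.

Lemma gdist_le_path i p : path e i p -> d i (last i p) <= size p.
Proof.
move=> ep; rewrite leqNgt; apply/negP => lt_pd.
(* [find] returns at most [n] even when the search fails, so [size p] is a valid index. *)
have dn : d i (last i p) <= n by rewrite -[X in _ <= X](size_iota 0) find_size.
have := before_find 0 lt_pd; rewrite nth_iota ?(leq_trans lt_pd) // add0n.
by move/negP; apply; apply/ballP; exists p.
Qed.

Lemma gdist0 i : d i i = 0.
Proof. by apply/eqP; rewrite -leqn0 (@gdist_le_path i [::]). Qed.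

Lemma gdist_eq0 i j : (d i j == 0) = (i == j).
Proof.
apply/eqP/eqP => [d0|->]; last exact: gdist0.
have [p [_ lp sp]] := gdist_path i j; move: sp lp; rewrite d0.
by move/eqP; rewrite size_eq0 => /eqP->.
Qed.

Lemma gdist_eq1 i j : (d i j == 1) = e i j.
Proof.
have [_ irr] := simple_e; apply/eqP/idP => [d1|eij].
  have [[|x [|y p]] [ep lp sp]] := gdist_path i j; move: sp; rewrite d1 //= => _.
  by move: ep lp; rewrite /= andbT => ei <-.
have := @gdist_le_path i [:: j]; rewrite /= eij => /(_ isT) le1.
apply/eqP; rewrite eqn_leq le1 lt0n gdist_eq0; apply: contraTneq eij => ->.
by rewrite irr.
Qed.

Lemma gdist_triangle j i k : d i k <= d i j + d j k.
Proof.
have [p [ep lp <-]] := gdist_path i j; have [q [eq lq <-]] := gdist_path j k.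
rewrite -size_cat -lq -lp -last_cat; apply: gdist_le_path.
by rewrite cat_path ep lp.
Qed.

Lemma gdist_sym i j : d i j = d j i.
Proof.
have [sym _] := simple_e.
suff le k l : d k l <= d l k by apply/eqP; rewrite eqn_leq !le.
have [p [ep lp <-]] := gdist_path l k.
have := @gdist_le_path k (rev (belast l p)).
rewrite -lp rev_path (eq_path (e' := e)) => [/(_ ep)|x y]; last exact: sym.
by rewrite size_rev size_belast; case: (p) => //= x q; rewrite rev_cons last_rcons.
Qed.

(** A geodesic is cut after [k] steps; the triangle inequality makes both pieces geodesics. *)
Lemma gdist_between i j k l : d i j = k + l -> exists2 x, d i x = k & d x j = l.
Proof.
have [p [ep lp sp]] := gdist_path i j => dkl; pose x := last i (take k p).
have sk : size (take k p) = k by rewrite size_takel // sp dkl leq_addr.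
have sl : size (drop k p) = l by rewrite size_drop sp dkl addKn.
move: ep lp; rewrite -{1 2}(cat_take_drop k p) cat_path last_cat => /andP[e1 e2] lp.
have := gdist_le_path e1; have := gdist_le_path e2; rewrite lp sk sl -/x => d2 d1.
have := gdist_triangle x i j; rewrite dkl => d3; exists x; apply/eqP.
  by rewrite eqn_leq d1 -(leq_add2r l) (leq_trans d3) // leq_add2l.
by rewrite eqn_leq d2 -(leq_add2l k) (leq_trans d3) // leq_add2r.
Qed.

End Distance.

Local Open Scope ring_scope.
Local Delimit Scope Z_scope with coqZ.

(** * Inertia of symmetric matrices *)

Lemma char_poly_conj (F : fieldType) n (A P : 'M[F]_n) :
  P \in unitmx -> char_poly (invmx P *m A *m P) = char_poly A.
Proof.
move=> Pu; pose Q := map_mx polyC P; pose Q' := map_mx polyC (invmx P).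
have Q'Q : Q' *m Q = 1%:M by rewrite -map_mxM mulVmx // map_mx1.
rewrite /char_poly /char_poly_mx !map_mxM -/Q -/Q'.
have -> : 'X%:M - Q' *m map_mx polyC A *m Q =
          Q' *m ('X%:M - map_mx polyC A) *m Q.
  by rewrite mulmxBr mulmxBl scalar_mxC -[_ *m Q' *m Q]mulmxA Q'Q mulmx1.
by rewrite !det_mulmx mulrAC -det_mulmx Q'Q det1 mul1r.
Qed.

Section RealSymmetric.
Local Open Scope complex_scope.
Local Open Scope sesquilinear_scope.

(** The complexification of [A] is Hermitian, hence normal and unitarily diagonalizable. Its
    characteristic polynomial splits over the image of [s], so the diagonal entries are real and are
    a permutation of [s]. *)
Lemma symmetric_spectral (R : rcfType) n (A : 'M[R]_n) (s : seq R) :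
  A^T = A -> char_poly A = \prod_(x <- s) ('X - x%:P) ->
  exists (P : 'M[R[i]]_n) (l : 'I_n -> R),
  [/\ P \is unitarymx, perm_eq s (codom l) &
      map_mx (real_complex R) A = P^t* *m diag_mx (\row_i (l i)%:C) *m P].
Proof.
move=> symA chA; set AC := map_mx _ A.
have nAC : AC \is normalmx.
  apply/normalmxP; suff -> : AC^t* = AC by [].
  apply/matrixP=> i j; rewrite !mxE -[in RHS]symA mxE.
  exact: (conjc_real (A j i)).
have /orthomx_spectralP := nAC; set P := spectralmx AC; set D := spectral_diag AC.
have uP : P \is unitarymx := spectral_unitarymx AC.
have Pu := unitarymx_unit uP => defA.
have chAC : char_poly AC = \prod_(x <- codom (D 0)) ('X - x%:P).
  rewrite defA char_poly_conj // char_poly_trig ?diag_mx_is_trig //.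
  rewrite /image_mem big_map big_enum /=.
  by apply: eq_bigr => i _; rewrite !mxE eqxx.
have /prod_XsubC_eq sD : \prod_(x <- map (real_complex R) s) ('X - x%:P) =
                         \prod_(x <- codom (D 0)) ('X - x%:P).
  rewrite -chAC -(map_char_poly (real_complex R)) chA rmorph_prod big_map.
  by apply: eq_bigr => x _; rewrite rmorphB /= map_polyX map_polyC.
pose l i := complex.Re (D 0 i); exists P, l.
have Dl i : D 0 i = (l i)%:C.
  have : D 0 i \in map (real_complex R) s by rewrite (perm_mem sD) codom_f.
  by rewrite /l; case/mapP => x _ ->.
split; first exact: uP.
  have := perm_map (@complex.Re R) sD; rewrite -map_comp map_id_in ?codomE // -map_comp.
  by congr perm_eq; apply: eq_map.
have -> : \row_i (l i)%:C = D by apply/rowP=> i; rewrite mxE Dl.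
rewrite -(invmx_unitary uP); exact: defA.
Qed.

Lemma kernel_vector (F : fieldType) (p q : nat) (K : 'M[F]_(p, q)) :
  (q < p)%N -> exists2 v : 'rV[F]_p, v != 0 & v *m K = 0.
Proof.
move=> ltqp; have : kermx K != 0.
  by rewrite kermx_eq0 /row_free neq_ltn (leq_ltn_trans (rank_leq_col K)).
by move/rowV0Pn=> [v /sub_kermxP vK v0]; exists v.
Qed.

Lemma rV_neq0P (F : pzRingType) k (v : 'rV[F]_k) : v != 0 -> exists i, v 0 i != 0.
Proof.
move=> v0; apply/existsP; rewrite -negb_forall; apply: contra v0 => /forallP v0.
by apply/eqP/rowP => i; rewrite mxE; apply/eqP.
Qed.

Section Inertia.
Variables (R : rcfType) (n : nat) (A : 'M[R]_n) (s : seq R) (c : R).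
Hypotheses (symA : A^T = A) (chA : char_poly A = \prod_(x <- s) ('X - x%:P)).

Local Notation toC := (map_mx (real_complex R)).

Lemma conj_toC m p (B : 'M[R]_(m, p)) : (toC B)^t* = toC B^T.
Proof. by apply/matrixP=> i j; rewrite !mxE; exact: (conjc_real (B j i)). Qed.

Lemma diag_formE (k : nat) (v : 'rV[R[i]]_k) (g : 'I_k -> R) :
  (v *m diag_mx (\row_i (g i)%:C) *m v^t*) 0 0 = \sum_i (g i)%:C * `|v 0 i| ^+ 2.
Proof.
rewrite mxE; apply: eq_bigr => i _.
by rewrite mul_mx_diag !mxE normCK mulrAC mulrC.
Qed.

Lemma diag_form_gt0 (k : nat) (v : 'rV[R[i]]_k) (g : 'I_k -> R) :
  v != 0 -> (forall i, v 0 i != 0 -> 0 < g i) ->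
  0 < \sum_i (g i)%:C * `|v 0 i| ^+ 2.
Proof.
move=> /rV_neq0P[i vi] g_gt0; rewrite (bigD1 i) //= ltr_wpDr ?sumr_ge0 // => [j _|].
  have [->|/g_gt0 gj] := eqVneq (v 0 j) 0; first by rewrite normr0 expr0n mulr0.
  by rewrite mulr_ge0 ?exprn_ge0 // ler0c ltW.
by rewrite mulr_gt0 ?exprn_gt0 ?normr_gt0 // (ltcR 0) g_gt0.
Qed.

Lemma shifted_spectral : exists (P : 'M[R[i]]_n) (l : 'I_n -> R),
  [/\ P \is unitarymx, #|[set i | c < l i]| = count (fun x => c < x) s &
      toC (A - c%:M) = P^t* *m diag_mx (\row_i (l i - c)%:C) *m P].
Proof.
have [P [l [uP sl defA]]] := symmetric_spectral symA chA; exists P, l.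
split; first exact: uP.
  rewrite (seq.permP sl) codomE count_map -sum1_card -sum1_count big_enum_cond.
  by apply: eq_bigl => i; rewrite inE.
rewrite raddfB /= defA.
have -> : diag_mx (\row_i (l i - c)%:C) = diag_mx (\row_i (l i)%:C) - (c%:C)%:M.
  by apply/matrixP=> i j; rewrite !mxE rmorphB mulrnBl.
rewrite mulmxBr mulmxBl; congr (_ - _).
rewrite map_scalar_mx scalar_mxC -mulmxA.
have /mulmx1C -> : P *m P^t* = 1%:M by exact/unitarymxP.
by rewrite mulmx1.
Qed.

(* Cauchy interlacing, as a lower bound on the positive inertia of A - c. *)
Lemma positive_count_ge k (U : 'M[R]_(k, n)) (g : 'I_k -> R) :
  U *m (A - c%:M) *m U^T = diag_mx (\row_i g i) -> (forall i, 0 < g i) ->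
  (k <= count (fun x => c < x)%R s)%N.
Proof.
move=> defg g_gt0; have [P [l [uP cardI defA]]] := shifted_spectral.
rewrite leqNgt -cardI; apply/negP; set I := [set i | _] => lt_k.
(* With fewer than [k] eigenvalues above [c], some nonzero combination of the rows of [U] is
   orthogonal to all their eigenvectors. There the form is positive by [defg] and nonpositive by the
   spectrum. *)
have [v v0 vK] := @kernel_vector _ _ _
  (colsub (fun i : 'I_#|I| => enum_val i) (toC U *m P^t*)) lt_k.
pose z := v *m toC U *m P^t*.
have z0 i : i \in I -> z 0 i = 0.
  move=> iI; have /rowP/(_ (enum_rank_in iI i)) := vK.
  rewrite [RHS]mxE => <-; rewrite /z -mulmxA !mxE; apply: eq_bigr => j _.
  by rewrite [in RHS]mxE enum_rankK_in.
have : 0 < \sum_i (g i)%:C * `|v 0 i| ^+ 2.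
  exact: diag_form_gt0.
have -> : \sum_i (g i)%:C * `|v 0 i| ^+ 2 = \sum_i (l i - c)%:C * `|z 0 i| ^+ 2.
  rewrite -!diag_formE.
  have -> : diag_mx (\row_i (g i)%:C) = toC (U *m (A - c%:M) *m U^T).
    by rewrite defg; apply/matrixP=> i j; rewrite !mxE rmorphMn.
  by rewrite !map_mxM defA /z !trmx_mul !map_mxM /= trmxCK conj_toC !mulmxA.
suff /le_gtF-> : \sum_i (l i - c)%:C * `|z 0 i| ^+ 2 <= 0 by [].
apply: sumr_le0 => i _; case: (boolP (i \in I)) => [/z0->|].
  by rewrite normr0 expr0n mulr0.
rewrite inE -leNgt => le_lc.
by rewrite mulr_le0_ge0 ?exprn_ge0 // (lecR _ 0) subr_le0.
Qed.

(** If more than [q] eigenvalues exceeded [c], the span of their eigenvectors would contain a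
    nonzero vector [x] killed by [Q]. The form of [A - c] is positive on it, yet there it equals
    minus the squared norm of [x *m B]. *)
Lemma positive_count_le q p (Q : 'M[R]_(n, q)) (M : 'M_(q, n)) (B : 'M_(n, p)) :
  A - c%:M = Q *m M - B *m B^T -> (count (fun x => c < x)%R s <= q)%N.
Proof.
move=> defAc; have [P [l [uP cardI defA]]] := shifted_spectral.
rewrite leqNgt -cardI; apply/negP; set I := [set i | _] => lt_q.
pose S : 'M[R[i]]_(#|I|, n) := \matrix_(i, j) (enum_val i == j)%:R.
have [w w0 wK] := @kernel_vector _ _ _ (S *m P *m toC Q) lt_q.
pose v := w *m S; pose x := v *m P.
have wv i : v 0 (enum_val i) = w 0 i.
  rewrite mxE (bigD1 i) //= !mxE eqxx mulr1 big1 ?addr0 // => j ji.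
  by rewrite mxE (inj_eq enum_val_inj) (negPf ji) mulr0.
have vI j : v 0 j != 0 -> j \in I.
  apply: contraR => jI; rewrite mxE big1 // => i _; rewrite mxE.
  case: eqP => [ij|_]; last exact: mulr0.
  by rewrite -ij enum_valP in jI.
have v0 : v != 0.
  by have [i wi] := rV_neq0P w0; apply: contra wi => /eqP v0; rewrite -wv v0 mxE.
have PP : P *m P^t* = 1%:M by exact/unitarymxP.
have xQ : x *m toC Q = 0 by rewrite /x /v -!mulmxA [S *m _]mulmxA wK.
have : 0 < \sum_i (l i - c)%:C * `|v 0 i| ^+ 2.
  by apply: diag_form_gt0 => // i /vI; rewrite inE subr_gt0.
rewrite -diag_formE.
have -> : v *m diag_mx (\row_i (l i - c)%:C) *m v^t* = x *m toC (A - c%:M) *m x^t*.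
  rewrite defA /x (trmx_mul v) map_mxM /= !mulmxA -[v *m P *m _]mulmxA PP mulmx1.
  by rewrite -[_ *m P *m P^t*]mulmxA PP mulmx1.
rewrite defAc raddfB /= !map_mxM mulmxBr mulmxBl !mulmxA xQ !mul0mx sub0r.
rewrite -[_ *m toC B^T *m _]mulmxA -conj_toC -map_mxM -trmx_mul.
rewrite 2!mxE oppr_gt0; apply/negP; rewrite le_gtF // sumr_ge0 // => i _.
by rewrite !mxE -normCK exprn_ge0.
Qed.

End Inertia.

(** Makes the sum of the squared distances a spectral invariant. *)
Lemma trace_sqr_char_poly (R : rcfType) (n : nat) (A : 'M[R]_n) (s : seq R) :
  A^T = A -> char_poly A = \prod_(x <- s) ('X - x%:P) ->
  \tr (A *m A) = \sum_(x <- s) x ^+ 2.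
Proof.
move=> symA chA; have [P [l [uP sl defA]]] := symmetric_spectral symA chA.
apply: (@complexI R); rewrite (perm_big _ sl) big_map big_enum /= [RHS]rmorph_sum /=.
transitivity (\tr (map_mx (real_complex R) A *m map_mx (real_complex R) A)).
  by rewrite -map_mxM trace_map_mx.
have PP : P *m P^t* = 1%:M by exact/unitarymxP.
rewrite defA mulmxA mxtrace_mulC !mulmxA PP mul1mx -[_ *m P *m P^t*]mulmxA PP mulmx1.
apply: eq_bigr => i _.
by rewrite mul_diag_mx !mxE eqxx mulr1n -expr2 rmorphXn.
Qed.

End RealSymmetric.

(** * Certificates for isometric subsets *)

Definition dotZ (v w : seq Z) : Z :=
  foldr (fun p a => (p.1 * p.2 + a)%coqZ) 0%coqZ (zip v w).

Definition bilZ (M : seq (seq Z)) (v w : seq Z) : Z :=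
  dotZ v [seq dotZ r w | r <- M].

(* q (D + (p / q) I): the zero entries of a distance matrix are the diagonal ones. *)
Definition shiftZ (p q : Z) (D : seq (seq nat)) : seq (seq Z) :=
  [seq [seq if d is 0%N then p else (q * Z.of_nat d)%coqZ | d <- r] | r <- D].

(** The vectors [vs] must be pairwise orthogonal with positive squares for [D + p / q], scaled by
    [q] to stay integral. [uniq D] forces the vertices realizing [D] to be distinct, since a
    repeated vertex would repeat a row. *)
Definition positive_cert (p q : Z) (D : seq (seq nat)) (vs : seq (seq Z)) : bool :=
  [&& uniq D, (0 <? q)%coqZ, all (fun v => size v == size D) vs &
      all (fun i => all (fun j =>
        let b := bilZ (shiftZ p q D) (nth [::] vs i) (nth [::] vs j) in
        if i == j then (0 <? b)%coqZ else (b =? 0)%coqZ)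
      (iota 0 (size vs))) (iota 0 (size vs))].

(** One Gram-Schmidt step with the denominator [bilZ M v v] cleared. *)
Definition orthogonal_pair (M : seq (seq Z)) (vw : seq Z * seq Z) : seq (seq Z) :=
  let: (v, w) := vw in
  [:: v; [seq (bilZ M v v * x.2 - bilZ M v w * x.1)%coqZ | x <- zip v w]].

Section Certificates.
Variables (R : rcfType) (n : nat) (e : rel 'I_n) (s : seq R).
Hypotheses (simple_e : simple_graph e) (connected_e : connected_graph e).
Hypothesis spec_e : char_poly (distmx R e) = \prod_(x <- s) ('X - x%:P).

Local Notation ZR z := ((int_of_Z z)%:~R : R).

Lemma distmx_sym : (distmx R e)^T = distmx R e.
Proof. by apply/matrixP=> i j; rewrite !mxE gdist_sym. Qed.

Lemma dotZ_map (T : Type) (xs : seq T) (F G : T -> Z) :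
  ZR (dotZ (map F xs) (map G xs)) = \sum_(x <- xs) ZR (F x) * ZR (G x).
Proof.
elim: xs => [|x xs IHxs]; first by rewrite big_nil.
rewrite big_cons -IHxs /= /dotZ /=.
by rewrite [int_of_Z _](rmorphD int_of_Z) (rmorphM int_of_Z) rmorphD rmorphM.
Qed.

Lemma ZR_gt0 z : (0 < z)%coqZ -> 0 < ZR z.
Proof. case: z => // k _; rewrite -[ZR _]/((Pos.to_nat k)%:R) ltr0n.
exact/ssrnat.ltP/Pos2Nat.is_pos. Qed.

Lemma sum_on_seq (T : finType) (xs : seq T) (G : T -> R) :
  uniq xs -> (forall x, x \notin xs -> G x = 0) -> \sum_x G x = \sum_(x <- xs) G x.
Proof.
move=> uxs G0; rewrite [RHS]big_uniq // [RHS]big_mkcond /=; apply: eq_bigr => x _.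
by case: ifPn => // /G0.
Qed.

(** Extended by zero outside [xs], the vectors have, for the whole distance matrix shifted by
    [p / q], the certified Gram matrix divided by [q]; interlacing then applies. *)
Lemma positive_certP p q (D : seq (seq nat)) vs (xs : seq 'I_n) :
  positive_cert p q D vs ->
  [seq [seq gdist e x y | y <- xs] | x <- xs] = D ->
  (size vs <= count (fun x => - (ZR p / ZR q) < x)%R s)%N.
Proof.
case/and4P=> uD q0 szv cert defD.
have uxs : uniq xs by move: uD; rewrite -defD; apply: map_uniq.
have szD : size D = size xs by rewrite -defD size_map.
pose F (i : 'I_(size vs)) x := nth 0%coqZ (nth [::] vs i) (index x xs).
have szF i : size (nth [::] vs (i : 'I_(size vs))) = size xs.
  by rewrite -szD; apply/eqP/(allP szv)/mem_nth.
have defF i : map (F i) xs = nth [::] vs i.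
  apply: (@eq_from_nth _ 0%coqZ); rewrite ?size_map ?szF // => k ltk.
  by case: xs uxs ltk @F szF {szD defD} => // x0 xs uxs ltk F szF;
     rewrite (nth_map x0) // /F index_uniq.
have F0 i x : x \notin xs -> F i x = 0%coqZ.
  by move=> xs'x; rewrite /F nth_default // szF leqNgt index_mem.
pose U : 'M[R]_(size vs, n) := \matrix_(i, x) ZR (F i x).
pose b i j := bilZ (shiftZ p q D) (nth [::] vs i) (nth [::] vs j).
have qR : 0 < ZR q.
  exact/ZR_gt0/Z.ltb_lt.
set c := - _.
have gram (i j : 'I_(size vs)) :
    (U *m (distmx R e - c%:M) *m U^T) i j = ZR (b i j) / ZR q.
  pose m x y := if gdist e x y is 0%N then p else (q * Z.of_nat (gdist e x y))%coqZ.
  have mE x y : (distmx R e - c%:M) x y = ZR (m x y) / ZR q.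
    rewrite !mxE /m; have := gdist_eq0 connected_e x y.
    case: (gdist e x y) => [|k] <-; first by rewrite sub0r mulr1n opprK.
    rewrite subr0 (rmorphM int_of_Z) intrM mulrAC divff ?gt_eqF // mul1r.
    by rewrite /= SuccNat2Pos.id_succ.
  have -> : b i j = dotZ (map (F i) xs)
                [seq dotZ (map (m x) xs) (map (F j) xs) | x <- xs].
    rewrite /b /bilZ !defF -defD /shiftZ -!map_comp; congr dotZ.
    by apply: eq_map => x /=; rewrite -map_comp.
  rewrite dotZ_map mulr_suml -mulmxA mxE (@sum_on_seq _ xs) // => [|x /F0 Fx].
    apply: eq_bigr => x _; rewrite dotZ_map -mulrA; congr (_ * _); first by rewrite mxE.
    rewrite mxE (@sum_on_seq _ xs) // => [|y /F0 Fy].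
      by rewrite mulr_suml; apply: eq_bigr => y _; rewrite mE !mxE mulrAC.
    by rewrite !mxE Fy mulr0.
  by rewrite mxE Fx mul0r.
apply: (@positive_count_ge R n (distmx R e) s c distmx_sym spec_e _ U
          (fun i => ZR (b i i) / ZR q)).
  apply/matrixP=> i j; rewrite gram !mxE; case: eqVneq => [->//|ij].
  have := allP (allP cert i _) j; rewrite !mem_iota !ltn_ord => /(_ isT isT).
  by rewrite /= val_eqE (negPf ij) => /Z.eqb_spec; rewrite /b => ->; rewrite mul0r.
move=> i; rewrite divr_gt0 //.
have := allP (allP cert i _) i; rewrite !mem_iota !ltn_ord => /(_ isT isT).
by rewrite /= eqxx => /Z.ltb_lt/ZR_gt0.
Qed.

End Certificates.

(** * Forbidden metrics and structure *)

Definition P4_extension (w : nat * nat * nat * nat) : seq (seq nat) :=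
  let: (i, j, k, l) := w in
  [:: [:: 0; 1; 2; 3; i]; [:: 1; 0; 1; 2; j]; [:: 2; 1; 0; 1; k];
      [:: 3; 2; 1; 0; l]; [:: i; j; k; l; 0]]%N.

(** Candidate planes: the shifted form of every forbidden extension of P4 is positive definite on at
    least one of them. The spanning pairs need not be orthogonal, as [orthogonal_pair] is applied
    first. *)
Definition positive_planes : seq (seq Z * seq Z) :=
  ([seq ([:: 2; 1; 1; 2; 2], w) | w <-
     [:: [:: 0; 1; -1; 1; 0]; [:: 1; -1; 1; 0; 0]; [:: 0; 0; 2; -1; -1];
         [:: 0; 2; -1; 1; 0]; [:: 1; -1; 0; 1; -1]; [:: 0; 0; 1; 0; 1];
         [:: 1; 0; 0; 1; -1]; [:: 1; -1; 2; 0; 0]]] ++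
   [:: ([:: 1; 1; 1; 1; 1], [:: -2; 8; -8; 3; -2]);
       ([:: 0; 0; 0; 1; 1], [:: -2; 4; -4; 2; 1]);
       ([:: 1; 1; 1; 1; 1], [:: -3; 8; -8; 2; 2]);
       ([:: 1; 0; 0; 0; 1], [:: -2; 4; -4; 2; -1])])%coqZ.

(* -33/58 lies between (17 - sqrt 329) / 2 = -0.56918 and the least second
   eigenvalue -0.56857 among the metrics certified below. *)
Definition plane_cert (D : seq (seq nat)) (vw : seq Z * seq Z) : bool :=
  positive_cert 33%coqZ 58%coqZ D (orthogonal_pair (shiftZ 33%coqZ 58%coqZ D) vw).

(** Exhaustive computation over all 81 tuples, whether or not they come from a metric. The last two
    exceptions are excluded later, by an adjacency argument. *)
Lemma P4_extension_cert i j k l :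
  i \in iota 1 3 -> j \in iota 1 3 -> k \in iota 1 3 -> l \in iota 1 3 ->
  (i, j, k, l) \in [:: (2, 1, 1, 2); (3, 2, 2, 3); (2, 2, 2, 2); (3, 3, 3, 3)]%N \/
  exists vw, plane_cert (P4_extension (i, j, k, l)) vw.
Proof.
pose W := [:: (2, 1, 1, 2); (3, 2, 2, 3); (2, 2, 2, 2); (3, 3, 3, 3)]%N.
have : all (fun i => all (fun j => all (fun k => all (fun l =>
    ((i, j, k, l) \in W) || has (plane_cert (P4_extension (i, j, k, l))) positive_planes)
  (iota 1 3)) (iota 1 3)) (iota 1 3)) (iota 1 3) by vm_compute.
move=> /allP chk /chk/allP{}chk /chk/allP{}chk /chk/allP{}chk /chk/orP[->|]; first by left.
by case/hasP=> vw _ cert; right; exists vw.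
Qed.

Section Structure.
Variables (R : rcfType) (n : nat) (e : rel 'I_n) (s : seq R).
Hypotheses (simple_e : simple_graph e) (connected_e : connected_graph e).
Hypothesis spec_e : char_poly (distmx R e) = \prod_(x <- s) ('X - x%:P).
Hypothesis count_s :
  (count (fun x => - ((int_of_Z 33%coqZ)%:~R / (int_of_Z 58%coqZ)%:~R) < x)%R s <= 1)%N.

Local Open Scope nat_scope.
Local Notation d := (gdist e).
Let d0 := gdist0 e.
Let dC := gdist_sym simple_e connected_e.
Let d_eq0 := gdist_eq0 connected_e.
Let d_eq1 := gdist_eq1 simple_e connected_e.
Let tri := gdist_triangle connected_e.
Let btw := gdist_between connected_e.

(** Two orthogonal positive vectors would give two eigenvalues above -33/58, against [count_s]. *)
Lemma no_plane_cert D xs vw :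
  plane_cert D vw -> [seq [seq d x y | y <- xs] | x <- xs] = D -> False.
Proof.
move=> cert defD; have := positive_certP simple_e connected_e spec_e cert defD.
by case: vw {cert} => v w /leq_trans/(_ count_s).
Qed.

Lemma no_plane_cert4 x y z w a b c f g h vw :
  plane_cert [:: [:: 0; a; b; c]; [:: a; 0; f; g]; [:: b; f; 0; h]; [:: c; g; h; 0]] vw ->
  d x y = a -> d x z = b -> d x w = c -> d y z = f -> d y w = g -> d z w = h -> False.
Proof.
move=> cert xy xz xw yz yw zw.
apply: (no_plane_cert (xs := [:: x; y; z; w]) cert) => /=.
rewrite !d0 [d y x]dC [d z x]dC [d z y]dC [d w x]dC [d w y]dC [d w z]dC.
by rewrite xy xz xw yz yw zw.
Qed.

Lemma gdist_eq2 x y z : x != y -> ~~ e x y -> e x z -> e z y -> d x y = 2.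
Proof.
rewrite -!d_eq0 -!d_eq1 => + + /eqP xz /eqP zy.
by have := tri z x y; rewrite xz zy; case: (d x y) => [|[|[|]]].
Qed.

(** Two distinct common neighbours would give an isometric diamond if adjacent and an isometric C4
    if not. *)
Lemma common_nbr_unique x y z w :
  x != y -> ~~ e x y -> e x z -> e z y -> e x w -> e w y -> z = w.
Proof.
have [eC _] := simple_e.
move=> xy nxy xz zy xw wy; apply/eqP/negPn/negP => zw.
have dxy := gdist_eq2 xy nxy xz zy.
have [ezw|nzw] := boolP (e z w).
  have := @no_plane_cert4 x y z w 2 1 1 1 1 1 ([:: 1; 1; 0; 0], [:: 0; 0; 1; 1])%coqZ.
  by apply=> //; apply/eqP; rewrite d_eq1 // eC.
have dzw : d z w = 2 by apply: (@gdist_eq2 _ _ x) => //; rewrite eC.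
have := @no_plane_cert4 x y z w 2 1 1 1 1 2 ([:: 1; 1; 1; 1], [:: 1; 1; -1; -1])%coqZ.
by apply=> //; apply/eqP; rewrite d_eq1 // eC.
Qed.

Lemma no_plane_cert5 x y z w u a b c c' f g g' h h' k vw :
  plane_cert [:: [:: 0; a; b; c; c']; [:: a; 0; f; g; g']; [:: b; f; 0; h; h'];
                 [:: c; g; h; 0; k]; [:: c'; g'; h'; k; 0]] vw ->
  d x y = a -> d x z = b -> d x w = c -> d x u = c' -> d y z = f -> d y w = g ->
  d y u = g' -> d z w = h -> d z u = h' -> d w u = k -> False.
Proof.
move=> cert xy xz xw xu yz yw yu zw zu wu.
apply: (no_plane_cert (xs := [:: x; y; z; w; u]) cert) => /=.
rewrite !d0 [d y x]dC [d z x]dC [d z y]dC [d w x]dC [d w y]dC [d w z]dC.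
by rewrite [d u x]dC [d u y]dC [d u z]dC [d u w]dC xy xz xw xu yz yw yu zw zu wu.
Qed.

(** All nonadjacent pairs of an induced C5 are at distance 2, so it is isometric; its second
    distance eigenvalue is (sqrt 5 - 3) / 2, about -0.38. *)
Lemma no_induced_C5 a v b z w :
  e a v -> e v b -> e b z -> e z w -> e w a ->
  a != b -> ~~ e a b -> v != w -> ~~ e v w -> w != b -> ~~ e w b ->
  a != z -> ~~ e a z -> v != z -> ~~ e v z -> False.
Proof.
have [eC _] := simple_e.
move=> av vb bz zw wa ab nab vw nvw wb nwb az naz vz nvz.
have := @no_plane_cert5 a v b z w 1 2 2 1 1 2 2 1 2 1
          ([:: 1; 1; 1; 1; 1], [:: -1; 1; -1; 0; 0])%coqZ.
apply=> //; try by apply/eqP; rewrite d_eq1 // eC.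
- exact: (gdist_eq2 ab nab av).
- by apply: (@gdist_eq2 _ _ w) => //; rewrite eC.
- exact: (gdist_eq2 vz nvz vb).
- by apply: (@gdist_eq2 _ _ a) => //; rewrite eC.
- by rewrite dC; apply: (@gdist_eq2 _ _ z) => //; rewrite eC.
Qed.

(** A larger distance yields a vertex [u] at distance exactly 4 from [x], and a geodesic x, w, v, t,
    u is an isometric P5. *)
Lemma gdist_le3 x y : d x y <= 3.
Proof.
rewrite leqNgt; apply/negP => gt3.
have [u xu _] := btw (etrans (esym (subnKC gt3)) erefl).
have [v xv vu] : exists2 v, d x v = 2 & d v u = 2 by apply: btw.
have [w xw wv] : exists2 w, d x w = 1 & d w v = 1 by apply: btw.
have [t vt tu] : exists2 t, d v t = 1 & d t u = 1 by apply: btw.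
have := @no_plane_cert5 x w v t u 1 2 3 4 1 2 3 1 2 1
          ([:: 2; 1; 1; 1; 2], [:: 0; 1; -1; 1; 0])%coqZ.
have := tri t x u; have := tri v x t; have := tri t w u; have := tri v w t.
have := tri w x t; have := tri w x u.
rewrite xu xv vu xw wv vt tu => t1 t2 t3 t4 t5 t6.
by apply=> //; lia.
Qed.

(** Unless the graph is complete, the universal vertex is the common neighbour [v] of any two
    nonadjacent vertices [a] and [b]. *)
Lemma universal_vertex : 0 < n -> (forall x y, d x y <= 2) ->
  exists v, forall x, x != v -> e v x.
Proof.
have [eC eI] := simple_e.
move=> n0 diam2.
have mid x y : x != y -> ~~ e x y -> exists2 z, e x z & e z y.
  move=> xy nxy; have [z xz zy] : exists2 z, d x z = 1 & d z y = 1.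
    apply: btw; have := diam2 x y; move: xy nxy; rewrite -d_eq0 -d_eq1.
    by case: (d x y) => [|[|[|]]].
  by exists z; rewrite -d_eq1 ?xz ?zy.
have [complete|] := boolP [forall x, forall y, (x != y) ==> e x y].
  exists (Ordinal n0) => x; rewrite eq_sym => xv.
  by move/forallP/(_ (Ordinal n0))/forallP/(_ x): complete; rewrite xv.
case/forallPn=> a /forallPn[b]; rewrite negb_imply => /andP[ab nab].
have [v av vb] := mid a b ab nab.
(* An edge from [w] to [a'] would close an induced C5 on a', v, b', z, w, with [z] a common
   neighbour of [w] and [b']; uniqueness of common neighbours excludes the chords. *)
have far a' b' w : a' != b' -> ~~ e a' b' -> e a' v -> e v b' ->
    w != v -> ~~ e v w -> ~~ e w a'.
  move=> ab' nab' av' vb' wv nvw; apply/negP => wa.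
  have nwb : ~~ e w b'.
    apply: contra wv => wb; apply/eqP.
    by apply: (common_nbr_unique ab' nab') => //; rewrite eC.
  have wb : w != b' by apply: contraNneq nvw => ->.
  have [z wz zb] := mid w b' wb nwb.
  have naz : ~~ e a' z.
    apply/negP => az; have zv := common_nbr_unique ab' nab' az zb av' vb'.
    by case/negP: nvw; rewrite -zv eC.
  have az : a' != z by apply: contraNneq nab' => ->.
  have nvz : ~~ e v z.
    apply/negP => vz; case/eqP: az.
    by apply: (@common_nbr_unique v w) => //; rewrite 1?eq_sym // eC.
  have vz : v != z by apply: contraNneq nvw => ->; rewrite eC.
  by apply: (@no_induced_C5 a' v b' z w); rewrite // 1?eC // eq_sym.
exists v => w wv; apply/negPn/negP => nvw.
have [x vx xw] := mid v w (contra_neq esym wv) nvw.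
have [ax|nax] := eqVneq a x; first by have := far a b w ab nab av vb wv nvw; rewrite ax eC xw.
have xb : x != b.
  by apply: contraTneq xw => ->; rewrite eC; apply: (far b a) => //; rewrite 1?eq_sym // eC.
(* The common neighbour [x] of [v] and [w] forms with [a] or [b] a nonadjacent pair centred at [v],
   so [far] denies the edge between [w] and [x]. *)
have [exa|nxa] := boolP (e a x).
  have nxb : ~~ e x b.
    apply/negP => exb; have xv := common_nbr_unique ab nab exa exb av vb.
    by rewrite xv eI in vx.
  have /negP[] : ~~ e w x by apply: (far x b); rewrite // eC.
  by rewrite eC.
have /negP[] : ~~ e w x by apply: (far x a); rewrite // 1?eq_sym // eC.
by rewrite eC.
Qed.

(** * Vertices around an isometric P4 *)

Definition isometric_P4 a b c f :=
  [/\ d a b = 1, d b c = 1 & d c f = 1] /\ [/\ d a c = 2, d b f = 2 & d a f = 3].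

Lemma isometric_P4_rev a b c f : isometric_P4 a b c f -> isometric_P4 f c b a.
Proof. by case=> -[ab bc cf] [ac bf af]; split; split; rewrite dC. Qed.

Lemma isometric_P4_exists x y : d x y = 3 -> exists b c, isometric_P4 x b c y.
Proof.
move=> xy; have [b xb yb] : exists2 b, d x b = 1 & d b y = 2 by apply: btw.
have [c bc cy] : exists2 c, d b c = 1 & d c y = 1 by apply: btw.
exists b, c; split; split=> //.
by have := tri b x c; have := tri c x y; rewrite xb bc cy xy; clear; lia.
Qed.

Lemma P4_vertex_type a b c f w :
  isometric_P4 a b c f -> w \notin [:: a; b; c; f] ->
  (d a w, d b w, d c w, d f w) \in [:: (2, 1, 1, 2); (3, 2, 2, 3); (2, 2, 2, 2); (3, 3, 3, 3)].
Proof.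
case=> -[ab bc cf] [ac bf af].
have d13 x : w != x -> d x w \in iota 1 3.
  by rewrite mem_iota eq_sym -d_eq0 -lt0n => ->; rewrite ltnS gdist_le3.
move=> w'; have /and4P[/d13 aw /d13 bw /d13 cw /d13 fw] :
  [&& w != a, w != b, w != c & w != f] by move: w'; rewrite !inE !negb_or.
have [//|[vw cert]] := P4_extension_cert aw bw cw fw.
exfalso; exact: (@no_plane_cert5 a b c f w _ _ _ _ _ _ _ _ _ _ vw cert).
Qed.

(** No admissible type has first entry 1, so [a] has no neighbour off the path, and on the path only
    [b]. *)
Lemma P4_end_nbr a b c f w : isometric_P4 a b c f -> e a w -> w = b.
Proof.
move=> P; rewrite -d_eq1 => /eqP aw; have [[ab bc cf] [ac bf af]] := P.
have [|/(P4_vertex_type P)] := boolP (w \in [:: a; b; c; f]); last first.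
  by rewrite !inE !xpair_eqE aw.
rewrite !inE => /or4P[]/eqP wE //; move: aw; rewrite wE ?ac ?af //.
by rewrite d0.
Qed.

(* The second vertex b is the only neighbour of the end a, hence d a w = 1 + d b w. *)
Lemma P4_vertex_type_graph a b c f w :
  isometric_P4 a b c f -> w \notin [:: a; b; c; f] ->
  [/\ d a w = 2, d b w = 1, d c w = 1 & d f w = 2] \/
  [/\ d a w = 3, d b w = 2, d c w = 2 & d f w = 3].
Proof.
move=> P w'; have := P4_vertex_type P w'.
have stepb k : d a w = k.+1 -> d b w = k.
  move=> aw; have [x ax xw] : exists2 x, d a x = 1 & d x w = k by apply: btw.
  by rewrite -(P4_end_nbr P (w := x)) // -d_eq1 ax.
rewrite !inE !xpair_eqE -!andbA.
by case/or4P=> /and4P[/eqP aw /eqP bw /eqP cw /eqP fw]; [left|right|..] => //;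
  have := stepb _ aw; rewrite bw.
Qed.

(** * Diameter 3: a clique with pendant vertices *)

Section PendantClique.
Variables (a b c f : 'I_n).
Hypothesis P : isometric_P4 a b c f.

(** The clique consists of the central edge [b], [c] and the common neighbours of its ends; all
    other vertices are to be pendant. *)
Definition pendant : pred 'I_n := fun x => (1 < d b x) || (1 < d c x).
(** A pendant vertex turns out to have a single neighbour, so [pick] has no choice there; the
    default [x] only serves vertices without neighbours. *)
Definition attachment x := odflt x [pick y | e x y].

Lemma core_type x : ~~ pendant x -> [\/ x = b, x = c | e b x /\ e c x].
Proof.
rewrite /pendant negb_or -!leqNgt => /andP[bx cx].
have [->|xb] := eqVneq x b; first by constructor 1.
have [->|xc] := eqVneq x c; first by constructor 2.
constructor 3; move: xb xc bx cx; rewrite ![x == _]eq_sym -!d_eq0 -!d_eq1.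
by case: (d b x) => [|[|]] //; case: (d c x) => [|[|]].
Qed.

(** Two nonadjacent common neighbours of [b] and [c] would themselves have the two common neighbours
    [b] and [c]. *)
Lemma core_clique x y : ~~ pendant x -> ~~ pendant y -> x != y -> e x y.
Proof.
have [eC eI] := simple_e; have [[_ bc _] _] := P.
have ebc : e b c by rewrite -d_eq1 bc.
have ecb : e c b by rewrite eC.
move=> /core_type[->|->|[bx cx]] /core_type[->|->|[by_ cy]] xy;
  rewrite ?eqxx // in xy; rewrite 1?eC //.
apply/negPn/negP; rewrite eC => nxy; have bcE : b = c.
  by apply: (common_nbr_unique xy nxy) => //; rewrite eC.
by move: ebc; rewrite bcE eI.
Qed.

(** Off the path a pendant [x] has type (3,2,2,3). The vertex [y] between [b] and [x] then has type
    (2,1,1,2), and x, y, b, a is an isometric P4. *)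
Lemma pendant_P4 x : pendant x -> exists y z u, isometric_P4 x y z u /\ ~~ pendant y.
Proof.
have [[ab bc cf] [ac bf af]] := P.
have pb : ~~ pendant b by rewrite /pendant d0 dC bc.
have pc : ~~ pendant c by rewrite /pendant d0 bc.
have [|x'] := boolP (x \in [:: a; b; c; f]).
  rewrite !inE => /or4P[]/eqP-> px; [|by rewrite px in pb|by rewrite px in pc|].
  - by exists b, c, f.
  - by exists c, b, a; split=> //; apply: isometric_P4_rev.
have [[ax bx cx fx]|[ax bx cx fx]] := P4_vertex_type_graph P x'.
  by rewrite /pendant bx cx.
move=> _; have [y by_ yx] : exists2 y, d b y = 1 & d y x = 1 by apply: btw.
have y' : y \notin [:: a; b; c; f].
  rewrite !inE !negb_or; apply/and4P; split; apply/eqP => yE; move: yx by_; rewrite yE.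
  - by rewrite ax.
  - by rewrite bx.
  - by rewrite cx.
  - by rewrite fx.
have [[ay _ cy fy]|[_ + _ _]] := P4_vertex_type_graph P y'; last by rewrite by_.
exists y, b, a; split; last by rewrite /pendant by_ cy.
by apply: isometric_P4_rev; split; split.
Qed.

Lemma pendant_nbr x : pendant x ->
  [/\ e x (attachment x), ~~ pendant (attachment x) & forall y, e x y -> y = attachment x].
Proof.
move=> px; have [y [z [u [Q py]]]] := pendant_P4 px; have [[xy _ _] _] := Q.
have exy : e x y by rewrite -d_eq1 xy.
have -> : attachment x = y.
  rewrite /attachment; case: pickP => [w /(P4_end_nbr Q)//|/(_ y)].
  by rewrite exy.
by split=> // w; apply: P4_end_nbr Q.
Qed.

(** Take an isometric P4 x, m, z, u. A second pendant vertex [y] attached to [m] must be of type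
    (2,1,1,2), hence adjacent to [z] as well, although [m] is its only neighbour. *)
Lemma attachment_inj : {in pendant &, injective attachment}.
Proof.
have [eC eI] := simple_e.
move=> x y px py sxy; apply/eqP/negPn/negP => xy.
have [exs ps nbx] := pendant_nbr px; have [eys _ nby] := pendant_nbr py.
have [m [z [u [Q _]]]] := pendant_P4 px.
have [[/eqP xm mz zu] [xz mu xu]] := Q.
have mE : m = attachment x by apply: nbx; rewrite -d_eq1.
have ym : d y m = 1 by apply/eqP; rewrite d_eq1 mE sxy.
have nyz : ~~ e y z.
  apply/negP => /nby zE; move: mz; rewrite zE mE sxy d0.
  by [].
have [|y'] := boolP (y \in [:: x; m; z; u]).
  rewrite !inE eq_sym (negPf xy) /= => /or3P[]/eqP yE.
  - by move: ym; rewrite yE d0.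
  - have /nby uE : e y u by rewrite yE -d_eq1 zu.
    by move: mu; rewrite uE -sxy -mE d0.
  - by move: ym; rewrite dC yE mu.
by have [[_ _ zy _]|[_ my _ _]] := P4_vertex_type_graph Q y';
  [rewrite -d_eq1 dC zy in nyz | rewrite dC my in ym].
Qed.

Lemma gdist_core x y : ~~ pendant x -> ~~ pendant y -> x != y -> d x y = 1.
Proof. by move=> px py xy; apply/eqP; rewrite d_eq1 core_clique. Qed.

Lemma gdist_pendant_core x y : pendant x -> ~~ pendant y ->
  d x y = if y == attachment x then 1 else 2.
Proof.
move=> px py; have [exs ps nbx] := pendant_nbr px.
case: eqVneq => [->|ys]; first by apply/eqP; rewrite d_eq1.
apply: (@gdist_eq2 _ _ (attachment x)) => //.
- by apply: contraTneq px => ->.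
- by apply: contra ys => /nbx ->.
- by rewrite core_clique // eq_sym.
Qed.

Lemma gdist_pendant x y : pendant x -> pendant y -> x != y -> d x y = 3.
Proof.
have [eC _] := simple_e.
move=> px py xy; have [exs ps nbx] := pendant_nbr px; have [_ _ nby] := pendant_nbr py.
have := gdist_le3 x y; have := xy; rewrite -d_eq0.
have : ~~ e x y by apply: contraL py => /nbx ->.
rewrite -d_eq1; case E: (d x y) => [|[|[|[|]]]] // _ _ _.
have [z xz zy] : exists2 z, d x z = 1 & d z y = 1 by apply: btw.
case/eqP: xy; apply: attachment_inj => //.
by rewrite -(nbx z) -?(nby z) // -d_eq1 ?xz // dC zy.
Qed.

Lemma pendant_card : 1 < #|[set x | pendant x]|.
Proof.
have [[ab bc cf] [ac bf af]] := P.
have <- : #|[set a; f]| = 2 by rewrite cards2 -d_eq0 af.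
apply: subset_leq_card; apply/subsetP=> x; rewrite !inE /pendant.
by case/orP=> /eqP->; [rewrite orbC dC ac | rewrite bf].
Qed.

(** A vertex off the path either completes the bull itself or is pendant, and then its attachment
    does. This separates the family from the windmills. *)
Lemma n_eq4_or_bull : n = 4 \/
  exists w, [/\ d a w = 2, d b w = 1, d c w = 1 & d f w = 2].
Proof.
have [[ab bc cf] [ac bf af]] := P.
have [/forallP all4|] := boolP [forall w, w \in [:: a; b; c; f]].
  left; have un : uniq [:: a; b; c; f].
    by rewrite /= !inE !negb_or -!d_eq0 ab ac af bc bf cf.
  by rewrite -[n]card_ord -[RHS](card_uniqP un); apply: eq_card => x; rewrite all4.
case/forallPn=> w w'; right.
have [?|[aw bw cw fw]] := P4_vertex_type_graph P w'; first by exists w.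
have pw : pendant w by rewrite /pendant bw.
have [ews ps nbw] := pendant_nbr pw.
have sw : d w (attachment w) = 1 by apply/eqP; rewrite d_eq1.
exists (attachment w); have y' : attachment w \notin [:: a; b; c; f].
  rewrite !inE !negb_or; apply/and4P; split; apply/eqP => yE; move: sw; rewrite yE dC.
  - by rewrite aw.
  - by rewrite bw.
  - by rewrite cw.
  - by rewrite fw.
have [//|[_ bs _ _]] := P4_vertex_type_graph P y'.
by rewrite /pendant bs in ps.
Qed.

End PendantClique.

End Structure.

(** * Determinants and polynomials of windmills *)

(** Sylvester's identity: one block matrix is factored into triangular ones in two ways. *)
Lemma det_sub_mulmxC (R : comPzRingType) m n (A : 'M[R]_(m, n)) (B : 'M_(n, m)) :
  \det (1%:M - A *m B) = \det (1%:M - B *m A).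
Proof.
have <- : \det (block_mx 1%:M A B 1%:M) = \det (1%:M - A *m B).
  have -> : block_mx 1%:M A B 1%:M =
            block_mx (1%:M - A *m B) A 0 1%:M *m block_mx 1%:M 0 B 1%:M.
    by rewrite mulmx_block !(mulmx1, mul1mx, mul0mx, mulmx0, addr0, add0r) subrK.
  by rewrite det_mulmx det_ublock det_lblock !det1 !mulr1.
have -> : block_mx 1%:M A B 1%:M =
          block_mx 1%:M 0 B 1%:M *m block_mx 1%:M A 0 (1%:M - B *m A).
  by rewrite mulmx_block !(mulmx1, mul1mx, mul0mx, mulmx0, addr0, add0r) addrC subrK.
by rewrite det_mulmx det_ublock det_lblock !det1 !mul1r.
Qed.

Lemma det_mx2 (R : comPzRingType) (A : 'M[R]_2) :
  \det A = A 0 0 * A 1 1 - A 0 1 * A 1 0.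
Proof.
rewrite (expand_det_row _ 0) !big_ord_recl big_ord0 addr0 /cofactor !det_mx11 !mxE.
rewrite /= expr0 expr1 mul1r mulN1r mulrN.
by congr (_ * A _ _ - _ * A _ _); try congr (A _ _); apply: val_inj.
Qed.

(** The positive integers provide more roots than a nonzero [p - q] can have. *)
Lemma eq_poly_pos (R : rcfType) (p q : {poly R}) :
  (forall y, 0 < y -> p.[y] = q.[y]) -> p = q.
Proof.
move=> pq; apply/eqP; rewrite -subr_eq0; apply/negPn/negP => pq0.
pose rs := [seq i.+1%:R : R | i <- iota 0 (size (p - q)%R)].
have : (size rs < size (p - q)%R)%N.
  apply: max_poly_roots => //.
    apply/allP=> _ /mapP[i _ ->]; rewrite /root hornerD hornerN pq ?ltr0n //.
    by rewrite subrr.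
  rewrite map_inj_uniq ?iota_uniq // => i j /eqP.
  by rewrite eqr_nat eqSS => /eqP.
by rewrite size_map size_iota ltnn.
Qed.

Section CliquePolynomial.
Variable R : rcfType.

(* The characteristic polynomial of - diag(J_k1, ..., J_kr). *)
Definition clique_poly (a : seq nat) : {poly R} :=
  \prod_(k <- a) ('X^(k.-1) * ('X + k%:R%:P)).

(** Logarithmic derivative: each factor contributes [(k - 1) + y / (y + k) = k - k / (y + k)] to y
    W' / W. *)
Lemma clique_poly_deriv a y : 0 < y -> all (leq 1) a ->
  (sumn a)%:R * (clique_poly a).[y] - y * (clique_poly a)^`().[y] =
  (clique_poly a).[y] * \sum_(k <- a) k%:R / (y + k%:R).
Proof.
move=> y0; rewrite /clique_poly; elim: a => [|k a IHa].
  by rewrite !big_nil (derivC (1 : R)) horner0 mul0r !mulr0 subr0.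
case/andP=> k0 /IHa{}IHa; rewrite !big_cons.
have -> : (sumn (k :: a))%:R = k%:R + (sumn a)%:R :> R by rewrite -natrD.
set w := 'X^(k.-1) * ('X + _); set W := (\prod_(_ <- _) _) in IHa *.
set S := (\sum_(_ <- _) _) in IHa *; rewrite (derivM w) hornerD !(hornerM _ W) (hornerM w).
have yk : y + k%:R != 0 by rewrite gt_eqF // ltr_wpDr.
have yS : y * W^`().[y] = (sumn a)%:R * W.[y] - W.[y] * S by rewrite -IHa; ring.
have wy : w.[y] = y ^+ k.-1 * (y + k%:R) by rewrite !hornerE.
have yD : y * w^`().[y] = k%:R * w.[y] - y ^+ k.-1 * k%:R :> R.
  rewrite wy /w derivM derivXn derivD derivX derivC.
  rewrite hornerD !hornerM !hornerD hornerX !hornerC hornerXn.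
  case: k k0 {yk w wy} => // -[|k] _; rewrite !succnK.
    by rewrite mulr0n horner0 expr0; ring.
  by rewrite hornerMn hornerXn exprS -mulr_natr -!natr1; ring.
transitivity (k%:R * w.[y] * W.[y] - (y * w^`().[y]) * W.[y]
   + w.[y] * ((sumn a)%:R * W.[y] - y * W^`().[y])); first by ring.
rewrite yD yS wy; field.
exact: yk.
Qed.

(** The nonzero roots, with multiplicity, are the numbers [- k] for [k] in the list. *)
Lemma clique_poly_inj a b : all (leq 1) a -> all (leq 1) b ->
  clique_poly a = clique_poly b -> perm_eq a b.
Proof.
pose F k : seq R := rcons (nseq k.-1 0) (- k%:R).
have clE c : clique_poly c = \prod_(x <- flatten (map F c)) ('X - x%:P).
  rewrite /clique_poly; elim: c => [|k c IHc]; first by rewrite !big_nil.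
  rewrite big_cons IHc /= big_cat; congr (_ * _); rewrite big_rcons /=.
  rewrite polyCN opprK; congr (_ * _).
  by rewrite big_nseq subr0 iter_mulr_1.
have nzE c : all (leq 1) c ->
    filter (fun x => x != 0) (flatten (map F c)) = [seq - k%:R : R | k <- c].
  elim: c => //= k c IHc /andP[k1 /IHc{}IHc]; rewrite filter_cat IHc filter_rcons.
  rewrite oppr_eq0 pnatr_eq0 -lt0n k1 (_ : filter _ _ = [::]) //.
  by apply/eqP; rewrite -size_eq0 size_filter count_nseq eqxx.
move=> a1 b1; rewrite !clE => /prod_XsubC_eq/(perm_filter (fun x => x != 0)).
rewrite !nzE // => /perm_map_inj; apply=> i j /oppr_inj/eqP.
by rewrite eqr_nat => /eqP.
Qed.

Definition windmill_transform (N : nat) (p : {poly R}) : {poly R} :=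
  ('X - 1) * p - ('X *+ 2 - 1) * (p *+ N - 'X * p^`()).

(* On a polynomial of degree d the leading coefficient is multiplied by the odd
   number 1 - 2 (N - d). *)
Lemma windmill_transform_inj N : injective (windmill_transform N).
Proof.
move=> p q pq; apply/eqP; rewrite -subr_eq0; apply/negPn/negP => nz.
set D := p - q in nz; have TD : windmill_transform N D = 0.
  have -> : windmill_transform N D = windmill_transform N p - windmill_transform N q.
    by rewrite /windmill_transform /D derivB mulrnBl; ring.
  by rewrite pq subrr.
clearbody D; pose d := (size D).-1; have szD : size D = d.+1 by rewrite /d prednK // size_poly_gt0.
have Dd : D`_d != 0 by rewrite -lead_coefE lead_coef_eq0.
have DS : D`_d.+1 = 0 by rewrite nth_default ?szD.
have XD k : ('X * D^`())`_k = D`_k *+ k.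
  by rewrite coefXM; case: k => [|k]; rewrite ?mulr0n // coef_deriv.
have /(congr1 (fun r : {poly R} => r`_d.+1)) := TD; rewrite coef0 => /eqP; apply/negP.
(* Only the summand multiplied by ['X] reaches the coefficient of index [d + 1]. *)
have -> : windmill_transform N D =
    'X * (D - (D *+ N - 'X * D^`()) *+ 2) - (D - (D *+ N - 'X * D^`())).
  by rewrite /windmill_transform; ring.
rewrite coefB coefXM /= !coefB coefMn coefB !coefMn !XD DS !mul0rn !subr0.
have -> : D`_d - (D`_d *+ N - D`_d *+ d) *+ 2 = D`_d * ((1 + 2 * d)%:R - (2 * N)%:R).
  by rewrite natrD !natrM; ring.
rewrite mulf_neq0 // subr_eq0 eqr_nat; apply/negP => /eqP/(congr1 odd).
by rewrite oddD !oddM.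
Qed.

End CliquePolynomial.

(** * Distance characteristic polynomial of a windmill *)

Section Windmill.
Variables (n : nat) (e : rel 'I_n).
Hypotheses (simple_e : simple_graph e) (connected_e : connected_graph e).
Variable v : 'I_n.
Hypothesis universal : forall x, x != v -> e v x.

(** Labels below [r] number the cliques left after removing [v]; the label [r] is reserved for
    [v]. *)
Definition windmill_labeling (r : nat) (k : 'I_n -> nat) :=
  [/\ k v = r, forall x, (k x < r)%N = (x != v),
      forall x y, x != v -> y != v -> x != y -> e x y = (k x == k y) &
      forall i, (i < r)%N -> exists x, k x = i].

Lemma windmill_labeling_exists :
  (forall x y z, x != v -> y != v -> z != v -> x != z -> e x y -> e y z -> e x z) ->
  exists r k, windmill_labeling r k.
Proof.
have [eC eI] := simple_e; move=> trans.
pose E x y := (x == y) || e x y; pose D := [set~ v].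
have eqE : {in D & &, equivalence_rel E}.
  move=> x y z; rewrite !inE => xv yv zv; split; first by rewrite /E eqxx.
  rewrite /E => /orP[/eqP->//|xy]; have [xz|xz] := eqVneq x z.
    by rewrite -xz [e y x]eC xy orbT.
  have [yz|yz] := eqVneq y z; first by rewrite -yz xy.
  rewrite /=; apply/idP/idP => [xz'|yz']; last exact: (trans _ y).
  by apply: (trans _ x) => //; rewrite eC.
pose P := equivalence_partition E D.
have partP : partition P D := equivalence_partitionP eqE.
have /and3P[/eqP covP trivP n0P] := partP.
(* [v] is not covered, so [pblock P v] is empty and not a block; its index is therefore the size of
   the enumeration. *)
pose k x := index (pblock P x) (enum P).
exists (size (enum P)), k.
have kP x : (k x < size (enum P))%N = (x != v).
  rewrite index_mem mem_enum; apply/idP/idP => [|xv].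
    apply: contraTneq => ->; rewrite /pblock; case: pickP => [B /andP[BP vB]|_] //=.
    have : v \in cover P by apply/bigcupP; exists B.
    by rewrite covP !inE eqxx.
  by apply: pblock_mem; rewrite covP !inE.
split=> //.
- apply/eqP; rewrite eqn_leq index_size leqNgt kP eqxx.
  by [].
- move=> x y xv yv xy.
  have kE : (k x == k y) = (pblock P x == pblock P y).
    apply/eqP/eqP => [|pxy]; last by rewrite /k pxy.
    have inP z : z != v -> pblock P z \in enum P by rewrite -kP index_mem.
    by move=> kxy; rewrite -(nth_index set0 (inP x xv)) -[index _ _]/(k x) kxy nth_index ?inP.
  rewrite kE eq_pblock ?covP ?inE // pblock_equivalence_partition ?inE //.
  by rewrite /E (negPf xy).
- move=> i ltir; have := mem_nth set0 ltir; rewrite mem_enum.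
  set B := nth _ _ _ => BP; have [x xB] : exists x, x \in B.
    by apply/set0Pn; apply: contraNneq n0P => <-.
  by exists x; rewrite /k (def_pblock trivP BP xB) index_uniq ?enum_uniq.
Qed.

Section CharPoly.
Variables (r : nat) (k : 'I_n -> nat).
Hypothesis lab : windmill_labeling r k.

Definition class_size i := #|[set x | k x == i]|.
Definition class_sizes := [seq class_size i | i <- iota 0 r].

Lemma windmill_gdist x y : gdist e x y =
  if x == y then 0%N else if [|| x == v, y == v | k x == k y] then 1%N else 2%N.
Proof.
have [eC eI] := simple_e; have [kv kr kE _] := lab.
have ge1 := gdist_eq1 simple_e connected_e.
case: eqVneq => [->|xy]; first exact: gdist0.
have [xv|xv] := eqVneq x v.
  by apply/eqP; rewrite ge1 xv universal // -xv eq_sym.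
have [yv|yv] := eqVneq y v.
  by apply/eqP; rewrite ge1 yv eC universal.
rewrite /= -kE //; case: ifPn => [|nxy]; first by rewrite -ge1 => /eqP.
have := gdist_triangle connected_e v x y.
have /eqP-> : gdist e x v == 1%N by rewrite ge1 eC universal.
have /eqP-> : gdist e v y == 1%N by rewrite ge1 universal.
move: xy nxy; rewrite -ge1 -(gdist_eq0 connected_e).
by case: (gdist e x y) => [|[|[|]]].
Qed.

Lemma class_size_gt0 i : (i < r)%N -> (0 < class_size i)%N.
Proof.
have [_ _ _ surj] := lab; case/surj=> x kx.
by apply/card_gt0P; exists x; rewrite inE kx.
Qed.

Lemma class_sizes_pos : all (leq 1) class_sizes.
Proof.
apply/allP=> _ /mapP[i + ->]; rewrite mem_iota => /andP[_ ir].
exact: class_size_gt0.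
Qed.

Lemma sum_by_class (R : nzRingType) (F : nat -> R) :
  \sum_(x | x != v) F (k x) = \sum_(a < r) (class_size a)%:R * F a.
Proof.
have [kv kr _ _] := lab.
(* [inord] needs a nonempty target; for [r = 0] there is no vertex besides [v]. *)
case: r kr => [|r'] kr.
  by rewrite big_ord0 big1 // => x; rewrite -kr.
rewrite (partition_big (fun x => inord (k x) : 'I_r'.+1) predT) //=.
apply: eq_bigr => a _; rewrite mulr_natl -sumr_const; apply: eq_big => [x|x].
  rewrite inE -kr; apply/andP/eqP => [[kx /eqP<-]|kx]; first by rewrite inordK.
  by rewrite kx ltn_ord inord_val.
by rewrite -kr => /andP[kx /eqP<-]; rewrite inordK.
Qed.

Section Evaluation.
Variable R : rcfType.
Local Notation D := (distmx R e).

Definition class_mx : 'M[R]_(n, r) := \matrix_(x, i) (k x == i)%:R.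
Definition frame_mx : 'M[R]_(n, 2) := \matrix_(x, i) (if i == 0 then 1 else (x == v)%:R).
(** With the columns of [frame_mx] (all ones, indicator of [v]) this form takes the value 1 in the
    row and column of [v] and 2 elsewhere; subtracting the clique blocks leaves [D + 1%:M]. *)
Definition frame_form : 'M[R]_2 :=
  \matrix_(i, j) (if (i == 0) && (j == 0) then 2 else if i == j then 1 else -1).

Lemma class_mx_tr x y :
  (class_mx *m class_mx^T) x y = ((x != v) && (k x == k y))%:R.
Proof.
have [_ kr _ _] := lab; rewrite -kr mxE; case: ltnP => /= kxr.
  rewrite (bigD1 (Ordinal kxr)) //= !mxE eqxx mul1r big1 ?addr0 1?eq_sym // => i ix.
  by rewrite !mxE eq_sym -[k x]/(val (Ordinal kxr)) val_eqE (negPf ix) mul0r.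
apply: big1 => i _; rewrite !mxE (_ : (k x == i) = false) ?mul0r //.
by apply/eqP => kxi; rewrite kxi leqNgt ltn_ord in kxr.
Qed.

Lemma class_mx_diag : class_mx^T *m class_mx = diag_mx (\row_i (class_size i)%:R).
Proof.
apply/matrixP=> i j; rewrite !mxE.
under eq_bigr => x _ do rewrite !mxE -natrM mulnb.
rewrite -natr_sum; case: eqVneq => [<-|ij]; last first.
  rewrite big1 // => x _; case: eqP => //= ->; apply/eqP.
  by rewrite eqb0 val_eqE.
rewrite mulr1n; congr _%:R; rewrite /class_size -sum1_card [in RHS]big_mkcond.
by apply: eq_bigr => x _; rewrite inE andbb; case: eqP.
Qed.

Lemma windmill_distmx :
  D + 1%:M = frame_mx *m (frame_form *m frame_mx^T) - class_mx *m class_mx^T.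
Proof.
have [kv kr _ _] := lab; apply/matrixP=> x y.
rewrite [in RHS]mxE [X in _ = _ + X]mxE class_mx_tr.
rewrite !mxE !big_ord_recl big_ord0 !mxE !big_ord_recl !big_ord0 !mxE /=.
rewrite windmill_gdist; have [xv|xv] := eqVneq x v; have [yv|yv] := eqVneq y v => /=.
- by rewrite xv yv eqxx /=; ring.
- by rewrite xv eq_sym (negPf yv) /=; ring.
- rewrite yv (negPf xv) (_ : (k x == k v) = false) /=; first by ring.
  by apply/eqP => kxv; have := kr x; rewrite xv kxv kv ltnn.
- by have [->|xy] := eqVneq x y; [rewrite eqxx /= | case: eqP => _ /=]; ring.
Qed.

Lemma sum_class_sizes : sumn class_sizes = n.-1.
Proof.
apply/eqP; rewrite -(eqr_nat R) sumnE big_map natr_sum.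
rewrite -[X in iota 0 X]subn0 -/(index_iota 0 r) big_mkord.
have := sum_by_class (fun=> 1 : R); rewrite sumr_const cardC1 card_ord => ->.
by apply/eqP/eq_bigr => i _; rewrite mulr1.
Qed.

Lemma horner_char_poly (A : 'M[R]_n) y : (char_poly A).[y] = \det (y%:M - A).
Proof.
rewrite /char_poly -horner_evalE -det_map_mx; congr determinant.
by apply/matrixP=> i j; rewrite !mxE /= /horner_eval hornerD hornerN hornerC hornerMn hornerX.
Qed.

Section AtPositive.
Variable y : R.
Hypothesis y_gt0 : 0 < y.

Let T : 'M[R]_n := y%:M + class_mx *m class_mx^T.
Let z x : R := if x == v then y^-1 else (y + (class_size (k x))%:R)^-1.
(** The closed form of the inverse of [T] applied to [frame_mx]: [T] multiplies the indicator of a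
    clique of size a by y + a, and that of [v] by y. *)
Let X : 'M[R]_(n, 2) := \matrix_(x, i) (if i == 0 then z x else (x == v)%:R / y).
Let sigma : R := \sum_(i < r) (class_size i)%:R / (y + (class_size i)%:R).

Let y_neq0 : y != 0. Proof. by rewrite gt_eqF. Qed.
Let ya_neq0 a : y + a%:R != 0. Proof. by rewrite gt_eqF // ltr_wpDr. Qed.

(** Sylvester's identity leaves a diagonal determinant of order [r]. As [n] is one more than the sum
    of the class sizes, one factor [y] is left over, for [v]. *)
Lemma det_class_mx : \det T = y * (clique_poly R class_sizes).[y].
Proof.
have -> : T = y *: (1%:M - (- y^-1 *: class_mx) *m class_mx^T).
  by rewrite -scalemxAl scaleNr opprK scalerDr scalerA divff // scale1r scalemx1.
rewrite detZ det_sub_mulmxC -scalemxAr class_mx_diag scaleNr opprK.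
have -> : 1%:M + y^-1 *: diag_mx (\row_i (class_size i)%:R) =
    diag_mx (\row_(i < r) (1 + (class_size i)%:R / y)).
  apply/matrixP=> i j; rewrite !mxE; case: eqP => _; last by rewrite !mulr0n mulr0 addr0.
  by rewrite !mulr1n mulrC.
rewrite det_diag /clique_poly horner_prod big_map -[X in iota 0 X]subn0.
rewrite -/(index_iota 0 r) big_mkord.
have -> : y ^+ n = y * \prod_(i < r) y ^+ class_size i.
  rewrite prodrXr -exprS; congr (_ ^+ _).
  have := sum_class_sizes; rewrite sumnE big_map -[X in iota 0 X]subn0.
  by rewrite -/(index_iota 0 r) big_mkord => ->; case: n v => // -[].
rewrite -mulrA -big_split /=; congr (_ * _); apply: eq_bigr => i _.
have := class_size_gt0 (ltn_ord i); rewrite mxE !hornerE.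
by case: (class_size i) => // a _; rewrite succnK exprS; field.
Qed.

Lemma frame_solve : T *m X = frame_mx.
Proof.
have [kv kr _ _] := lab; rewrite mulmxDl mul_scalar_mx; apply/matrixP=> x i.
have -> : (y *: X + class_mx *m class_mx^T *m X) x i =
    y * X x i + \sum_j (class_mx *m class_mx^T) x j * X j i.
  by rewrite mxE [in LHS]mxE; congr (_ + _); rewrite mxE.
rewrite [in RHS]mxE.
have sumv (F : 'I_n -> R) : x = v ->
    \sum_j (class_mx *m class_mx^T) x j * F j = 0.
  by move=> xv; apply: big1 => j _; rewrite class_mx_tr xv eqxx mul0r.
have [xv|xv] := eqVneq x v.
  rewrite sumv // addr0 mxE /z xv eqxx mul1r; case: ifP => _; exact: divff.
rewrite mxE /z (negPf xv) mul0r; case: ifP => i0; last first.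
  rewrite mulr0 add0r; apply: big1 => j _; rewrite class_mx_tr mxE i0 xv /=.
  have [->|_] := eqVneq j v; last by rewrite mul0r mulr0.
  rewrite (_ : (k x == k v) = false) ?mul0r //.
  by apply/eqP => kxv; have := kr x; rewrite xv kxv kv ltnn.
set a := class_size (k x).
have -> : \sum_j (class_mx *m class_mx^T) x j * X j i = a%:R * (y + a%:R)^-1.
  rewrite mulr_natl -sumr_const [RHS]big_mkcond; apply: eq_bigr => j _.
  rewrite class_mx_tr xv inE eq_sym /= mxE i0 /z.
  case: eqP => [kjx|_]; last by rewrite mul0r.
  have jv : j != v by rewrite -kr kjx kr.
  by rewrite mul1r (negPf jv) kjx.
by rewrite -mulrDl divff.
Qed.

(** Here [y - 1 - D] is [T] minus a rank-two term. Factoring out [T] and using Sylvester's identity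
    again leaves a determinant of order 2, whose entries come from [G]. *)
Lemma windmill_char_poly : (char_poly D).[y - 1] =
  (clique_poly R class_sizes).[y] * ((y - 1) - (2 * y - 1) * sigma).
Proof.
have [kv kr _ _] := lab.
have -> : (char_poly D).[y - 1] =
    \det (T *m (1%:M - X *m (frame_form *m frame_mx^T))).
  rewrite horner_char_poly mulmxBr mulmx1 (mulmxA T X) frame_solve; congr determinant.
  have -> : (y - 1)%:M - D = y%:M - (D + 1%:M).
    by rewrite raddfB /= opprD addrA addrAC.
  by rewrite windmill_distmx opprB addrA addrAC.
rewrite det_mulmx det_class_mx det_sub_mulmxC -mulmxA.
set G := frame_mx^T *m X.
have GE i j : G i j = \sum_x frame_mx x i * X x j.
  by rewrite mxE; apply: eq_bigr => x _; rewrite mxE.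
have Gv j : G 1 j = X v j.
  rewrite GE (bigD1 v) //= mxE /= eqxx mul1r big1 ?addr0 // => x xv.
  by rewrite mxE /= (negPf xv) mul0r.
have G00 : G 0 0 = y^-1 + sigma.
  rewrite GE (bigD1 v) //= !mxE /= /z eqxx mul1r; congr (_ + _).
  rewrite /sigma -(sum_by_class (fun i => (y + (class_size i)%:R)^-1)).
  apply: eq_bigr => x xv.
  by rewrite !mxE /= /z (negPf xv) mul1r.
have G01 : G 0 1 = y^-1.
  rewrite GE (bigD1 v) //= !mxE /= eqxx !mul1r big1 ?addr0 // => x xv.
  by rewrite !mxE /= (negPf xv) mul0r mulr0.
have G10 : G 1 0 = y^-1 by rewrite Gv mxE /= /z eqxx.
have G11 : G 1 1 = y^-1 by rewrite Gv mxE /= eqxx mul1r.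
rewrite det_mx2.
have SG i j : (1%:M - frame_form *m G) i j =
    (i == j)%:R - (frame_form i 0 * G 0 j + frame_form i 1 * G 1 j).
  rewrite [LHS]mxE [X in X + _]mxE [X in _ + X]mxE; congr (_ - _).
  have l01 : lift ord0 ord0 = 1 :> 'I_2 by exact: val_inj.
  by rewrite mxE !big_ord_recl big_ord0 addr0 l01.
rewrite !SG G00 G01 G10 G11 !mxE /=.
by field.
Qed.
End AtPositive.

(** It suffices to compare values at positive [y], where [clique_poly_deriv] trades the sum over the
    cliques for a derivative. *)
Lemma windmill_char_poly_shift :
  char_poly D \Po ('X - 1) = windmill_transform n.-1 (clique_poly R class_sizes).
Proof.
apply: eq_poly_pos => y y0; rewrite horner_comp hornerD hornerX hornerN hornerC.
rewrite windmill_char_poly // /windmill_transform.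
set W := clique_poly R class_sizes.
rewrite hornerD hornerN (hornerM _ W) (hornerM _ (_ - _)) !hornerD !hornerN.
rewrite (hornerM 'X) !hornerMn !hornerX !hornerC.
have := clique_poly_deriv y0 class_sizes_pos; rewrite sum_class_sizes -/W big_map.
rewrite -[X in iota 0 X]subn0 -/(index_iota 0 r) big_mkord mulr_natl => ->.
by ring.
Qed.

Lemma windmill_count (s : seq R) : char_poly D = \prod_(x <- s) ('X - x%:P) ->
  (count (fun x => -1 < x)%R s <= 2)%N.
Proof.
move=> chD; have symD := distmx_sym R simple_e connected_e.
apply: (@positive_count_le R n D s (-1) symD chD 2 r frame_mx
          (frame_form *m frame_mx^T) class_mx).
by rewrite raddfN opprK windmill_distmx.
Qed.

End Evaluation.

End CharPoly.
End Windmill.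

(** * Isomorphism of windmills *)

Lemma windmill_labeling_adj n (e : rel 'I_n) v r k :
  simple_graph e -> (forall x, x != v -> e v x) -> windmill_labeling e v r k ->
  forall x y, x != y -> e x y = [|| k x == r, k y == r | k x == k y].
Proof.
move=> [eC eI] univ [kv kr kE _] x y xy.
have kxr z : (k z == r) = (z == v).
  apply/eqP/eqP => [kzr|->//]; apply/eqP; rewrite -[_ == _]negbK -kr kzr.
  by rewrite ltnn.
rewrite !kxr; have [xv|xv] := eqVneq x v; first by rewrite xv univ // -xv eq_sym.
have [yv|yv] := eqVneq y v; first by rewrite yv eC univ.
by rewrite kE.
Qed.

(** Each label becomes its position in [Is]; as [r] is absent from [Is], the label of [v] stays
    [r]. *)
Lemma windmill_relabel n (e : rel 'I_n) v r k (Is : seq nat) :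
  perm_eq Is (iota 0 r) -> windmill_labeling e v r k ->
  windmill_labeling e v r (fun x => index (k x) Is).
Proof.
move=> pI [kv kr kE ks]; have szI : size Is = r by rewrite (perm_size pI) size_iota.
have memI i : (i \in Is) = (i < r)%N by rewrite (perm_mem pI) mem_iota.
split.
- by rewrite -[RHS]szI; apply: memNindex; rewrite memI kv ltnn.
- by move=> x; rewrite -[X in (_ < X)%N]szI index_mem memI.
- move=> x y xv yv xy; rewrite kE //; apply/eqP/eqP => [->//|].
  by apply: (index_inj 0%N); rewrite memI kr.
- move=> i ltir; have [|x kx] := ks (nth 0%N Is i).
    by rewrite -memI mem_nth ?szI.
  by exists x; rewrite kx index_uniq ?szI // (perm_uniq pI) iota_uniq.
Qed.

Lemma windmill_class_size n (e : rel 'I_n) v r k i :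
  windmill_labeling e v r k -> (r <= i)%N -> class_size k i = (i == r).
Proof.
move=> [kv kr _ _] ri; rewrite /class_size.
have kxr z : (k z == i) = (z == v) && (i == r).
  apply/eqP/andP => [kzi|[/eqP-> /eqP->]//]; have zv : z == v.
    by rewrite -[_ == _]negbK -kr kzi -leqNgt.
  by rewrite zv -kzi (eqP zv) kv.
case: (i == r) in kxr *; last first.
  by apply/eqP; rewrite cards_eq0; apply/eqP/setP=> x; rewrite !inE kxr andbF.
by rewrite -[RHS](cards1 v); apply: eq_card => x; rewrite !inE kxr andbT.
Qed.

(** Renumbering the cliques of [f] equalizes the sizes label by label. The two label tuples then
    differ by a permutation of the vertices, and adjacency depends on labels only. *)
Lemma windmill_iso n (e f : rel 'I_n) v w r k q l :
  simple_graph e -> (forall x, x != v -> e v x) -> windmill_labeling e v r k ->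
  simple_graph f -> (forall x, x != w -> f w x) -> windmill_labeling f w q l ->
  perm_eq (class_sizes r k) (class_sizes q l) -> graph_iso e f.
Proof.
move=> se ue lk sf uf ll pkl.
have qr : q = r.
  by have := perm_size pkl; rewrite /class_sizes !size_map !size_iota.
subst q; have [Is pI kI] := perm_iotaP 0%N pkl.
rewrite size_map size_iota in pI; have {ll} ll := windmill_relabel pI ll.
have szI : size Is = r by rewrite (perm_size pI) size_iota.
have memI i : (i \in Is) = (i < r)%N by rewrite (perm_mem pI) mem_iota.
have uI : uniq Is by rewrite (perm_uniq pI) iota_uniq.
set l' := fun x => index (l x) Is in ll.
have cards i : (i < r)%N -> class_size k i = class_size l' i.
  move=> ir; have := congr1 (fun s => nth 0%N s i) kI.
  rewrite (nth_map 0%N) ?size_iota // nth_iota // add0n => ->.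
  rewrite (nth_map 0%N) ?szI // (nth_map 0%N) ?size_iota; last first.
    by rewrite -memI mem_nth ?szI.
  rewrite nth_iota ?add0n; last by rewrite -memI mem_nth ?szI.
  apply: eq_card => x; rewrite !inE /l'; apply/eqP/eqP => [->|lxi].
    by rewrite index_uniq ?szI.
  by rewrite -lxi nth_index // -index_mem szI lxi.
pose K := [tuple k x | x < n]; pose L := [tuple l' x | x < n].
have /tuple_permP[p /val_inj pE] : perm_eq K L.
  have cnt (h : 'I_n -> nat) i : count_mem i [tuple h x | x < n] = class_size h i.
    rewrite count_map -sum1_count big_enum_cond /class_size -sum1_card.
    by apply: eq_bigl => x; rewrite inE.
  apply/allP => i _; apply/eqP; rewrite /= !cnt; have [/cards->//|ri] := ltnP i r.
  by rewrite (windmill_class_size lk ri) (windmill_class_size ll ri).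
exists p; split; first by exists (p^-1)%g => x; rewrite (permK, permKV).
have lk' x : l' (p x) = k x.
  by have := congr1 (fun t => tnth t x) pE; rewrite !tnth_mktuple.
have [[_ fI] [_ eI]] := (sf, se).
move=> x y; have [->|xy] := eqVneq x y; first by rewrite fI eI.
rewrite (windmill_labeling_adj se ue lk) // (windmill_labeling_adj sf uf ll) ?lk' //.
by rewrite (inj_eq perm_inj).
Qed.

(** * Cliques with pendant vertices *)

(** Phrased through distances so as to give both the adjacency and the sum of squares. *)
Definition pendant_clique n (e : rel 'I_n) (p : pred 'I_n) (sup : 'I_n -> 'I_n) : Prop :=
  [/\ forall x y, ~~ p x -> ~~ p y -> x != y -> gdist e x y = 1%N,
      forall x y, p x -> ~~ p y -> gdist e x y = if y == sup x then 1%N else 2%N,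
      forall x y, p x -> p y -> x != y -> gdist e x y = 3%N,
      forall x, p x -> ~~ p (sup x) & {in p &, injective sup}].

Lemma sum_affine n (a b : nat) (q : 'I_n -> nat) :
  (\sum_x (a + b * q x) = n * a + b * \sum_x q x)%N.
Proof. by rewrite big_split -big_distrr /= sum_nat_const card_ord. Qed.

Lemma sum2D n (F G : 'I_n -> 'I_n -> nat) :
  (\sum_x \sum_y (F x y + G x y) = \sum_x \sum_y F x y + \sum_x \sum_y G x y)%N.
Proof. by rewrite -big_split; apply: eq_bigr => x _; rewrite big_split. Qed.

Lemma sum2M n c (F : 'I_n -> 'I_n -> nat) :
  (\sum_x \sum_y c * F x y = c * \sum_x \sum_y F x y)%N.
Proof. by rewrite big_distrr; apply: eq_bigr => x _; rewrite big_distrr. Qed.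

Section Sums.
Local Open Scope nat_scope.
Variables (n : nat) (e : rel 'I_n).
Hypotheses (simple_e : simple_graph e) (connected_e : connected_graph e).
Local Notation d := (gdist e).

(** [1 + 3 * p x + 3 * p y + 2 * (p x * p y)] is 1, 4 or 9 according to the number of pendant
    vertices. This is the squared distance except on attached pairs (excess 3) and on the diagonal
    (excess 1 or 9). *)
Lemma sum_sqr_pendant_clique p sup : pendant_clique e p sup ->
  let t := #|[set x | p x]| in
  \sum_x \sum_y d x y ^ 2 + n + 14 * t = n ^ 2 + 6 * n * t + 2 * t ^ 2.
Proof.
case=> cc pc pp ps inj t.
have sump : \sum_x (p x : nat) = t.
  rewrite /t -sum1_card [RHS]big_mkcond; apply: eq_bigr => x _.
  by rewrite inE; case: (p x).
pose m x y : nat := p x && (y == sup x).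
have sumn1 : \sum_(x < n) 1 = n by rewrite sum1_card card_ord.
have summ : \sum_x \sum_y m x y = t.
  rewrite -sump; apply: eq_bigr => x _; rewrite (bigD1 (sup x)) //= /m eqxx andbT.
  by rewrite big1 ?addn0 // => y /negPf->; rewrite andbF.
have summ' : \sum_x \sum_y m y x = t by rewrite exchange_big.
have sumd : \sum_x \sum_y (x == y) * (1 + 8 * p x) = n + 8 * t.
  transitivity (\sum_x (1 + 8 * p x)); last first.
    by rewrite big_split -big_distrr /= sump sumn1.
  apply: eq_bigr => x _; rewrite (bigD1 x) //= eqxx mul1n big1 ?addn0 // => y /negPf.
  by rewrite eq_sym => ->.
have key x y : d x y ^ 2 + (3 * m x y + 3 * m y x + (x == y) * (1 + 8 * p x)) =
    1 + 3 * p x + 3 * p y + 2 * (p x * p y).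
  rewrite /m; have [->|xy] := eqVneq x y.
    rewrite gdist0 //=; case py : (p y) => //=; rewrite (_ : (y == sup y) = false) //.
    by apply: contraTF (ps y py) => /eqP <-; rewrite py.
  have [px|px] := boolP (p x); have [py|py] := boolP (p y) => /=.
  - have -> : (x == sup y) = false.
      by apply: contraTF (ps y py) => /eqP <-; rewrite px.
    have -> : (y == sup x) = false.
      by apply: contraTF (ps x px) => /eqP <-; rewrite py.
    by rewrite (pp x y px py xy).
  - by rewrite (pc x y px py); case: eqP.
  - by rewrite gdist_sym // (pc y x py px); case: eqP.
  - by rewrite (cc x y px py xy).
have : \sum_x \sum_y (d x y ^ 2 + (3 * m x y + 3 * m y x + (x == y) * (1 + 8 * p x))) =
       \sum_x \sum_y (1 + 3 * p x + 3 * p y + 2 * (p x * p y)).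
  by apply: eq_bigr => x _; apply: eq_bigr => y _; exact: key.
have -> : \sum_x \sum_y (1 + 3 * p x + 3 * p y + 2 * (p x * p y)) =
          n * (n + 3 * t) + (3 * n + 2 * t) * t.
  transitivity (\sum_x ((n + 3 * t) + (3 * n + 2 * t) * p x)); last first.
    by rewrite sum_affine sump.
  apply: eq_bigr => x _.
  transitivity (\sum_y ((1 + 3 * p x) + (3 + 2 * p x) * p y)).
    by apply: eq_bigr => y _; lia.
  by rewrite sum_affine sump; lia.
by rewrite sum2D (sum2D (fun x y => 3 * m x y + 3 * m y x)) sum2D !sum2M summ summ' sumd; nia.
Qed.

(** The bound is the value for a star, where all distances avoiding the centre are 2. *)
Lemma sum_sqr_windmill v r k : (forall x, x != v -> e v x) ->
  windmill_labeling e v r k ->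
  \sum_x \sum_y d x y ^ 2 + 10 * n <= 4 * n ^ 2 + 6.
Proof.
move=> univ lab.
have sumn1 : \sum_(x < n) 1 = n by rewrite sum1_card card_ord.
have sumv : \sum_x (x == v) = 1.
  by rewrite (bigD1 v) //= eqxx big1 // => x /negPf->.
have sumxy : \sum_(x < n) \sum_(y < n) (x == y) = n.
  rewrite -[RHS]sumn1; apply: eq_bigr => x _; rewrite (bigD1 x) //= eqxx.
  by rewrite big1 // => y /negPf; rewrite eq_sym => ->.
have : \sum_x \sum_y (d x y ^ 2 + (4 * (x == y) + (3 * (x == v) + 3 * (y == v)))) <=
       \sum_x \sum_y (4 + 6 * ((x == v) * (y == v))).
  apply: leq_sum => x _; apply: leq_sum => y _.
  rewrite (windmill_gdist simple_e connected_e univ lab).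
  have [xv|xv] := eqVneq x v; have [yv|yv] := eqVneq y v; rewrite ?xv ?yv ?eqxx //=.
  - by rewrite eq_sym (negPf yv).
  - by rewrite (negPf xv).
  - by case: eqP => //=; case: eqP.
have -> : \sum_x \sum_y (4 + 6 * ((x == v) * (y == v))) = n * (n * 4) + 6 * 1.
  transitivity (\sum_x (n * 4 + 6 * (x == v))); last by rewrite sum_affine sumv.
  apply: eq_bigr => x _.
  by rewrite (sum_affine 4 6 (fun y => (x == v) * (y == v))) -big_distrr /= sumv muln1.
have sumvx : \sum_(x < n) \sum_(y < n) (x == v) = n.
  under eq_bigr => x _ do rewrite sum_nat_const card_ord.
  by rewrite -big_distrr /= sumv muln1.
have sumvy : \sum_(x < n) \sum_(y < n) (y == v) = n by rewrite (eq_bigr (fun=> 1)).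
rewrite sum2D (sum2D (fun x y => 4 * (x == y))) (sum2D (fun x y => 3 * (x == v))) !sum2M.
by rewrite sumxy sumvx sumvy; nia.
Qed.

End Sums.

Lemma iso_of_common_model n (e f : rel 'I_n) (M : nat -> nat -> bool) (phi psi : 'I_n -> 'I_n) :
  injective phi -> (forall i j, e (phi i) (phi j) = M i j) ->
  injective psi -> (forall i j, f (psi i) (psi j) = M i j) -> graph_iso e f.
Proof.
move=> iphi eM ipsi fM; exists (psi \o invF iphi); split.
  exists (phi \o invF ipsi) => x /=; first by rewrite invF_f f_invF.
  by rewrite invF_f f_invF.
by move=> x y /=; rewrite fM -eM !f_invF.
Qed.

(** Indices below [t] are pendant, [i + t] is the attachment of [i], and the indices from [t] on
    form the clique. *)
Definition pendant_model (t i j : nat) : bool :=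
  if (i < t)%N then (j == i + t)%N
  else if (j < t)%N then (i == j + t)%N else i != j.

Lemma pendant_clique_model n (e : rel 'I_n) p sup :
  simple_graph e -> connected_graph e -> pendant_clique e p sup ->
  exists2 phi : 'I_n -> 'I_n, injective phi &
    forall i j, e (phi i) (phi j) = pendant_model #|[set x | p x]| i j.
Proof.
move=> se ce [cc pc pp ps inj]; have [eC eI] := se.
have eE x y := esym (gdist_eq1 se ce x y).
set t := #|_|; pose A := enum [set x | p x]; pose S := map sup A.
pose B := enum [set x | ~~ p x & x \notin S].
have memA x : (x \in A) = p x by rewrite mem_enum inE.
have memB x : (x \in B) = ~~ p x && (x \notin S) by rewrite mem_enum inE.
have memS x : x \in S -> ~~ p x.
  by case/mapP=> z; rewrite memA => pz ->; apply: ps.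
have uS : uniq S.
  by rewrite map_inj_in_uniq ?enum_uniq // => x y; rewrite !memA; apply: inj.
(* Pendant vertices, then their attachments in the same order, then the rest of the clique. *)
pose L := A ++ S ++ B.
have uL : uniq L.
  rewrite !cat_uniq !enum_uniq uS /= andbT; apply/andP; split.
    apply/hasPn=> x; rewrite /= mem_cat memA => /orP[/memS//|].
    by rewrite memB => /andP[].
  by apply/hasPn=> x; rewrite memB => /andP[].
have sA : size A = t by rewrite -cardE.
have sS : size S = t by rewrite size_map.
clearbody t.
have sL : size L = n.
  rewrite -(card_uniqP uL) -[RHS]card_ord; apply: eq_card => x.
  rewrite !mem_cat memA memB inE; case: (p x) => //=.
  by case: (x \in S).
have szB : (t + (t + size B) = n)%N by have := sL; rewrite !size_cat sA sS.
pose phi (i : 'I_n) := nth i L i.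
have phiE i x0 : phi i = nth x0 L i by apply: set_nth_default; rewrite sL.
have iphi : injective phi.
  move=> i j; rewrite (phiE j i) /phi => /eqP; rewrite nth_uniq ?sL // => /eqP.
  exact: val_inj.
have phiA (i : 'I_n) x0 : (i < t)%N -> phi i = nth x0 A i.
  by move=> it; rewrite (phiE _ x0) nth_cat sA it.
have phip (i : 'I_n) : p (phi i) = (i < t)%N.
  have [it|ti] := ltnP i t.
    by rewrite (phiA _ i) // -memA mem_nth ?sA.
  apply/negbTE; rewrite /phi nth_cat sA ltnNge ti /= nth_cat sS.
  case: ltnP => it; first by apply: memS; rewrite mem_nth ?sS.
  suff : nth i B (i - t - t) \in B by rewrite memB => /andP[].
  rewrite mem_nth //; have := ltn_ord i; move: szB it; clear; move: (size B) => b; lia.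
have phis (i j : 'I_n) : (i < t)%N -> (phi j == sup (phi i)) = (j == i + t :> nat)%N.
  move=> it; have -> : sup (phi i) = nth i L (i + t).
    rewrite nth_cat sA ltnNge leq_addl /= addnK nth_cat sS it.
    by rewrite (nth_map i) ?sA // -phiA.
  by rewrite (phiE j i) nth_uniq ?sL //; lia.
exists phi => // i j; rewrite /pendant_model.
have [it|ti] := ltnP i t.
  have pi : p (phi i) by rewrite phip.
  have [pj|pj] := boolP (p (phi j)).
    have -> : (j == i + t :> nat)%N = false.
      by move: pj; rewrite phip => pj; apply/negbTE/eqP => jit; move: pj; rewrite jit; lia.
    have [->|ij] := eqVneq i j; first by rewrite eI.
    by rewrite eE pp ?(inj_eq iphi).
  by rewrite eE pc // -phis //; case: (phi j == _).
have pi : ~~ p (phi i) by rewrite phip -leqNgt.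
have [jt|tj] := ltnP j t.
  have pj : p (phi j) by rewrite phip.
  by rewrite eC eE pc // -phis //; case: (phi i == _).
have pj : ~~ p (phi j) by rewrite phip -leqNgt.
have [->|ij] := eqVneq i j; first by rewrite eI eqxx.
by rewrite eE cc ?(inj_eq iphi).
Qed.

Lemma pendant_clique_iso n (e f : rel 'I_n) p sup q sup' :
  simple_graph e -> connected_graph e -> pendant_clique e p sup ->
  simple_graph f -> connected_graph f -> pendant_clique f q sup' ->
  #|[set x | p x]| = #|[set x | q x]| -> graph_iso e f.
Proof.
move=> se ce pe sf cf pf tt.
have [phi iphi eM] := pendant_clique_model se ce pe.
have [psi ipsi fM] := pendant_clique_model sf cf pf.
by apply: (iso_of_common_model iphi eM ipsi) => i j; rewrite fM tt.
Qed.

(** * Comparison of cospectral graphs *)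

Lemma sum_sqr_cospectral (R : rcfType) n (e f : rel 'I_n) (s : seq R) :
  simple_graph e -> connected_graph e -> simple_graph f -> connected_graph f ->
  char_poly (distmx R e) = \prod_(x <- s) ('X - x%:P) ->
  char_poly (distmx R f) = \prod_(x <- s) ('X - x%:P) ->
  (\sum_x \sum_y gdist e x y ^ 2 = \sum_x \sum_y gdist f x y ^ 2)%N.
Proof.
move=> se ce sf cf che chf.
have trE (g : rel 'I_n) : simple_graph g -> connected_graph g ->
    \tr (distmx R g *m distmx R g) = (\sum_x \sum_y gdist g x y ^ 2)%:R.
  move=> sg cg; rewrite natr_sum; apply: eq_bigr => x _.
  rewrite mxE natr_sum; apply: eq_bigr => y _.
  by rewrite !mxE (gdist_sym sg cg y x) -natrM mulnn.
apply/eqP; rewrite -(eqr_nat R) -!trE //.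
by rewrite !(trace_sqr_char_poly (s := s)) // distmx_sym.
Qed.

Lemma second_eigenvalue_count (R : rcfType) (s : seq R) :
  sorted (fun x y => y <= x) s -> s`_1 <= (17 - Num.sqrt 329) / 2 ->
  (1 < size s)%N /\
  (count (fun x => - ((int_of_Z 33%coqZ)%:~R / (int_of_Z 58%coqZ)%:~R) < x)%R s <= 1)%N.
Proof.
have -> : (int_of_Z 33%coqZ)%:~R = 33%:R :> R by [].
have -> : (int_of_Z 58%coqZ)%:~R = 58%:R :> R by [].
have c0 : (17 - Num.sqrt 329) / 2 <= - (33 / 58) :> R.
  (* 17 - 526/29 = -33/29, twice the threshold -33/58. *)
  have : 526 / 29 <= Num.sqrt 329 :> R.
    rewrite -[X in X <= _](ger0_norm (_ : 0 <= 526 / 29)) ?divr_ge0 //.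
    by rewrite -sqrtr_sqr ler_sqrt //; lra.
  by lra.
(* On a list with fewer than two entries the default value 0 exceeds the bound. *)
case: s => [|x [|y s]] /=; [move=> _ s1; exfalso; lra|move=> _ s1; exfalso; lra|].
case/andP=> _ pys s1; split=> //.
rewrite (_ : count _ s = 0%N); last first.
  apply/eqP; rewrite -leqn0 leqNgt -has_count; apply/hasPn => z zs.
  have : z <= y.
    apply: (allP (order_path_min _ pys)) => // u v w vu uw; exact: le_trans uw vu.
  by rewrite -leNgt; lra.
have -> : (- (33%:R / 58%:R) < y) = false by apply/negbTE; rewrite -leNgt; lra.
by case: (_ < x).
Qed.

Lemma windmill_or_pendant_clique (R : rcfType) n (e : rel 'I_n) (s : seq R) :
  simple_graph e -> connected_graph e -> (0 < n)%N ->
  char_poly (distmx R e) = \prod_(x <- s) ('X - x%:P) ->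
  (count (fun x => - ((int_of_Z 33%coqZ)%:~R / (int_of_Z 58%coqZ)%:~R) < x)%R s <= 1)%N ->
  (exists v r k, (forall x, x != v -> e v x) /\ windmill_labeling e v r k) \/
  (exists p sup, [/\ pendant_clique e p sup, (1 < #|[set x | p x]|)%N &
     n = 4 \/ (2 < count (fun x => -1 < x)%R s)%N]).
Proof.
move=> se ce n0 che cnt; have [eC _] := se.
have [diam2|] := boolP [forall x, forall y, (gdist e x y <= 2)%N].
  left; have [|v univ] := universal_vertex se ce che cnt n0.
    by move=> x y; move/forallP/(_ x)/forallP: diam2.
  have [|r [k lab]] := @windmill_labeling_exists n e se v; last by exists v, r, k.
  (* If [x] and [z] were nonadjacent, [y] and [v] would be two common neighbours of them. *)
  move=> x y z xv yv zv xz xy yz; apply/negPn/negP => nxz.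
  case/eqP: yv; apply: (common_nbr_unique se ce che cnt xz nxz xy yz).
    by rewrite eC univ.
  exact: univ.
case/forallPn=> x /forallPn[y]; rewrite -ltnNge => d3; right.
have dxy : gdist e x y = 3%N.
  by apply/eqP; rewrite eqn_leq d3 andbT (gdist_le3 se ce che cnt).
have [b [c P]] := isometric_P4_exists ce dxy.
exists (pendant e b c), (attachment e); split.
- split.
  + exact: (gdist_core se ce che cnt P).
  + exact: (gdist_pendant_core se ce che cnt P).
  + exact: (gdist_pendant se ce che cnt P).
  + by move=> u /(pendant_nbr se ce che cnt P)[].
  + exact: (attachment_inj se ce che cnt P).
- exact: (pendant_card se ce P).
have [n4|[w [xw bw cw yw]]] := n_eq4_or_bull se ce che cnt P; [by left|right].
(* Three vectors orthogonal and positive for [D + 1%:M] of the bull, hence three eigenvalues above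
   -1. *)
pose vs := [:: [:: 1; 1; 1; 1; 1]; [:: -1; 2; -2; 1; 0]; [:: -5; 32; 32; -5; -42]]%coqZ.
have cert : positive_cert 1%coqZ 1%coqZ (P4_extension (2, 1, 1, 2)%N) vs by vm_compute.
have := positive_certP se ce che (xs := [:: x; b; c; y; w]) cert.
rewrite (_ : ((int_of_Z 1%coqZ)%:~R : R) / (int_of_Z 1%coqZ)%:~R = 1); last exact: divr1.
apply; have dC := gdist_sym se ce; have [[xb bc cy] [xc by_ _]] := P.
rewrite /= !gdist0 (dC b x) (dC c x) (dC c b) (dC y x) (dC y b) (dC y c).
by rewrite (dC w x) (dC w b) (dC w c) (dC w y) xb bc cy xc by_ dxy xw bw cw yw.
Qed.

Theorem theorem3p7 (R : rcfType) (n : nat) (e : rel 'I_n) (s : seq R) :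
  simple_graph e -> connected_graph e ->
  is_Dspectrum e s ->
  s`_1 <= (17 - Num.sqrt 329) / 2 ->
  forall (m : nat) (f : rel 'I_m),
    simple_graph f -> connected_graph f ->
    is_Dspectrum f s ->
    graph_iso e f.
Proof.
move=> se ce [sorted_s che] s1 m f sf cf [_ chf].
have size_s k (g : rel 'I_k) : char_poly (distmx R g) = \prod_(x <- s) ('X - x%:P) ->
    size s = k.
  by move/(congr1 (fun p : {poly R} => size p)); rewrite size_char_poly size_prod_XsubC => -[].
have mn : m = n by rewrite -(size_s _ _ chf) (size_s _ _ che).
subst m; have sn := size_s _ _ che; have [n2 cnt] := second_eigenvalue_count sorted_s s1.
have n0 : (0 < n)%N by rewrite -sn ltnW.
have sumE := sum_sqr_cospectral se ce sf cf che chf.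
have mixed (g h : rel 'I_n) v r k p sup : simple_graph g -> connected_graph g ->
    char_poly (distmx R g) = \prod_(x <- s) ('X - x%:P) ->
    simple_graph h -> connected_graph h ->
    (\sum_x \sum_y gdist g x y ^ 2 = \sum_x \sum_y gdist h x y ^ 2)%N ->
    (forall x, x != v -> g v x) -> windmill_labeling g v r k ->
    pendant_clique h p sup -> (1 < #|[set x | p x]|)%N ->
    n = 4 \/ (2 < count (fun x => -1 < x)%R s)%N -> False.
  move=> sg cg chg sh ch sgh univ lab pc t2 [n4|]; last first.
    by rewrite ltnNge (windmill_count sg cg univ lab chg).
  (* For [n = 4] the windmill has sum at most 30, while two or more pendant vertices give at least
     40. *)
  have := sum_sqr_windmill sg cg univ lab.
  have := sum_sqr_pendant_clique sh ch pc; rewrite /= sgh.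
  move: t2; move: (\sum_x _)%N #|_| => S t t2; rewrite [n in (n ^ 2)%N]n4 n4.
  by nia.
have [[v [r [k [ue lk]]]]|[p [sup [pe te ne]]]] :=
  windmill_or_pendant_clique se ce n0 che cnt;
have [[w [q [l [uf ll]]]]|[p' [sup' [pf tf nf]]]] :=
  windmill_or_pendant_clique sf cf n0 chf cnt.
- apply: (windmill_iso se ue lk sf uf ll).
  apply: (@clique_poly_inj R); [exact: (class_sizes_pos lk)|exact: (class_sizes_pos ll)|].
  apply: (@windmill_transform_inj R n.-1).
  rewrite -(windmill_char_poly_shift se ce ue lk) -(windmill_char_poly_shift sf cf uf ll).
  by rewrite che chf.
- by case: (mixed e f v r k p' sup').
- by case: (mixed f e w q l p sup).
apply: (pendant_clique_iso se ce pe sf cf pf).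
have := sum_sqr_pendant_clique se ce pe; have := sum_sqr_pendant_clique sf cf pf.
rewrite /= sumE; rewrite sn in n2.
(* Equal sums give (t - t') (6 n + 2 (t + t') - 14) = 0, and the second factor is positive since n,
   t and t' are at least 2. *)
move: te tf n2; move: (\sum_x _)%N #|[set x | p x]| #|[set x | p' x]| => S t t'; clear.
nia.
Qed.
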